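(* Let $m>\frac52$, $s\in\mathbb{R}$, and let $(u,\rho)\in C\bigl([0,T);H^m(\mathbb{S}^1)\times H^{m-1}(\mathbb{S}^1)\bigr)$ be a solution of the magnetic two-component Hunter--Saxton system with magnetic parameter $s$ (see context) with initial data $(u_0,\rho_0)\in H^m(\mathbb{S}^1)\times H^{m-1}(\mathbb{S}^1)$. Assume $c=1$ and $\delta\neq0$, and let $\varphi$ be the flow of $u$, i.e. $\varphi_t(t,x)=u(t,\varphi(t,x))$, $\varphi(0,x)=x$. With $\theta_1,\theta_2$ as in the context, write $\omega=\theta_1-\theta_2$ and $T_\omega(t)=\tan\bigl(\tfrac{\omega}{2}t\bigr)$. Then: (1) The quantities $u_x\circ\varphi$ and $\rho\circ\varphi$ admit the explicit representation $$u_x\bigl(t,\varphi(t,x)\bigr)=\frac{\bigl(-\omega\,T_\omega(t)+(u_0)_x(x)\bigr)\Bigl(1+(u_0)_x(x)\frac{T_\omega(t)}{\omega}\Bigr)+(\rho_0(x)-s)^2\,\frac{T_\omega(t)}{\omega}}{\Bigl(1+(u_0)_x(x)\frac{T_\omega(t)}{\omega}\Bigr)^2+\Bigl((\rho_0(x)-s)\frac{T_\omega(t)}{\omega}\Bigr)^2},$$ $$\rho\bigl(t,\varphi(t,x)\bigr)=\frac{\bigl(1+T_\omega(t)^2\bigr)(\rho_0(x)-s)}{\Bigl(1+(u_0)_x(x)\frac{T_\omega(t)}{\omega}\Bigr)^2+\Bigl((\rho_0(x)-s)\frac{T_\omega(t)}{\omega}\Bigr)^2}.$$ (2) The functions $u_x\circ\varphi$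 and $\rho\circ\varphi$ develop a singularity if and only if there exist $x_0\in\mathbb{S}^1$ and $t_0>0$ such that $$\rho_0(x_0)=s\qquad\text{and}\qquad t_0=\frac{2\,\operatorname{arccot}\Bigl(-\frac{(u_0)_x(x_0)}{\theta_1-\theta_2}\Bigr)}{\theta_1-\theta_2}.$$
   Context: $\mathbb{S}^1=\mathbb{R}/\mathbb{Z}$. The magnetic two-component Hunter--Saxton system with magnetic parameter $s\in\mathbb{R}$ is $$u_{tx}=-\tfrac12u_x^2-u\,u_{xx}+\tfrac12\rho^2-\bigl(s\rho+2(c^2-s\delta)\bigr),\qquad \rho_t=-(\rho u)_x+s\,u_x,\qquad u(0,\cdot)=u_0,\quad \rho(0,\cdot)=\rho_0,$$ where $c^2=\frac14\int_{\mathbb{S}^1}(u_x^2+\rho^2)\,dx$ (the $\dot H^1$-energy) and $\delta=\frac12\int_{\mathbb{S}^1}\rho\,dx$ (the contact angle); both are conserved along smooth solutions. Set $$\theta_{1/2}=\frac{s\pm\sqrt{s^2+4(c^2-s\delta)}}{2}$$ ($+$ for $\theta_1$, $-$ for $\theta_2$).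
   Formalization: The printed formula for ρ(t,φ(t,x)) fails at t=0 when s≠0; the fraction equals ρ∘φ−s, so the formal version has ρ∘φ = s + fraction. As T need not be maximal, ''singularity'' means finite-time unboundedness of the pair, continued past T by its equations along the flow. *)

(* Defs.v *)
From Stdlib Require Export Reals.
From Coquelicot Require Export Coquelicot.
Open Scope R_scope.

(* Functions on S^1 = R/Z are 1-periodic functions on R, and
   int_{S^1} is the integral over [0,1]. *)

(* |f^(n)|^2 for the n-th Fourier coefficient of a real-valued f. *)
Definition fourier_sq (f : R -> R) (n : nat) : R :=
  (RInt (fun x => f x * cos (2 * PI * INR n * x)) 0 1) ^ 2
  + (RInt (fun x => f x * sin (2 * PI * INR n * x)) 0 1) ^ 2.

(* For real f the coefficients of index n and -n have the same modulus, so
   summing over n >= 0 gives a norm equivalent to the one summed over Z. *)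
Definition sobolev_term (m : R) (f : R -> R) (n : nat) : R :=
  Rpower (1 + INR n ^ 2) m * fourier_sq f n.

(* H^m(S^1), through continuous representatives: only meant for m > 1/2. *)
Definition sobolev (m : R) (f : R -> R) : Prop :=
  (forall x, f (x + 1) = f x) /\
  (forall x, continuous f x) /\
  ex_series (sobolev_term m f).

Definition sobolev_norm (m : R) (f : R -> R) : R :=
  sqrt (Series (sobolev_term m f)).

(* The time interval [0,T), with T finite or infinite. *)
Definition lifespan (T : Rbar) (t : R) : Prop := 0 <= t /\ Rbar_lt t T.

(* Derivative relative to [0,T): one-sided at t = 0. *)
Definition is_derive_on (T : Rbar) (f : R -> R) (t l : R) : Prop :=
  filterlim (fun tau => (f tau - f t) / (tau - t))
    (within (lifespan T) (locally' t)) (locally l).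

(* f \in C([0,T); H^m(S^1)) *)
Definition C_sobolev (T : Rbar) (m : R) (f : R -> R -> R) : Prop :=
  forall t, lifespan T t ->
    sobolev m (f t) /\
    filterlim (fun tau => sobolev_norm m (fun x => f tau x - f t x))
      (within (lifespan T) (locally t)) (locally 0).

(* c, where c^2 = 1/4 int (f_x^2 + g^2) *)
Definition energy_c (f g : R -> R) : R :=
  sqrt (/ 4 * RInt (fun x => Derive f x ^ 2 + g x ^ 2) 0 1).

Definition contact_angle (g : R -> R) : R := / 2 * RInt g 0 1.

Definition theta1 (s c delta : R) : R :=
  (s + sqrt (s ^ 2 + 4 * (c ^ 2 - s * delta))) / 2.
Definition theta2 (s c delta : R) : R :=
  (s - sqrt (s ^ 2 + 4 * (c ^ 2 - s * delta))) / 2.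

(* The branch with values in (0, PI). *)
Definition arccot (y : R) : R := PI / 2 - atan y.

(* c and delta in the equation are those of the current state
   (u t, rho t); their conservation is not part of the definition. *)
Definition magnetic_HS_solution (s m : R) (T : Rbar) (u rho : R -> R -> R)
    (u0 rho0 : R -> R) : Prop :=
  C_sobolev T m u /\
  C_sobolev T (m - 1) rho /\
  (forall x, u 0 x = u0 x) /\
  (forall x, rho 0 x = rho0 x) /\
  (forall t x, lifespan T t ->
     is_derive_on T (fun tau => Derive (u tau) x) t
       (- (1 / 2) * Derive (u t) x ^ 2 - u t x * Derive_n (u t) 2 x
        + 1 / 2 * rho t x ^ 2
        - (s * rho t x
           + 2 * (energy_c (u t) (rho t) ^ 2 - s * contact_angle (rho t)))) /\
     is_derive_on T (fun tau => rho tau x) t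
       (- Derive (fun y => rho t y * u t y) x + s * Derive (u t) x)).

Definition is_flow (T : Rbar) (u phi : R -> R -> R) : Prop :=
  (forall x, phi 0 x = x) /\
  (forall t x, lifespan T t ->
     is_derive_on T (fun tau => phi tau x) t (u t (phi t x))).

(* The system read along the flow: since
   d/dt (f o phi) = (f_t + u f_x) o phi, the pair V = u_x o phi,
   W = rho o phi of a solution satisfies these equations. *)
Definition lagrangian_system (s c delta : R) (T : Rbar) (V W : R -> R -> R)
    : Prop :=
  forall t x, lifespan T t ->
    is_derive_on T (fun tau => V tau x) t
      (- (1 / 2) * V t x ^ 2 + 1 / 2 * W t x ^ 2
       - (s * W t x + 2 * (c ^ 2 - s * delta))) /\
    is_derive_on T (fun tau => W tau x) t (- W t x * V t x + s * V t x).

(* The pair (v, w), given on [0,T), becomes unbounded in finite time.  T need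
   not be maximal, so the blow-up time t1 may exceed T: the pair is then
   continued by the equations it satisfies along the flow.  Continuing
   (u, rho) itself would not be the same: the system leaves the mean of u
   free, and a wild mean prevents continuation of u without affecting
   u_x o phi and rho o phi. *)
Definition develops_singularity (s c delta : R) (T : Rbar)
    (v w : R -> R -> R) : Prop :=
  exists (t1 : R) (V W : R -> R -> R),
    0 < t1 /\
    (forall t x, lifespan T t -> lifespan t1 t ->
       V t x = v t x /\ W t x = w t x) /\
    lagrangian_system s c delta t1 V W /\
    (forall M : R, exists t x,
       lifespan t1 t /\ M < Rabs (V t x) + Rabs (W t x)).

(* Main.v *)
Require Import Defs.
From Stdlib Require Import ZArith Lra Lia FunctionalExtensionality Classical.

(* Along the flow, y = u_x o phi + i (rho o phi - s) solves the Riccati equation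
   y' = - (y^2 + omega^2) / 2 pointwise in x, because c and delta are conserved and
   omega^2 = s^2 + 4 (c^2 - s delta).  Hence y = 2 w' / w with
   w = cos (omega t / 2) + y(0) sin (omega t / 2) / omega, which gives the formulas.
   As y blows up exactly where w vanishes, and w has a zero only if y(0) is real, the
   first singularity sits at a minimum of u0' over the zero set of rho0 - s.
   For c = 1, Cauchy-Schwarz gives omega^2 >= 0, with omega = 0 only at the stationary
   states u0' = 0, rho0 = s.  The regularity needed to differentiate along the flow and
   under the integral sign is the Sobolev embedding, obtained from the Fourier series,
   which represents f because its Cesaro means converge to f (Fejer). *)

(** * Fourier inversion *)

(** Blow-up asks for unboundedness over t and x jointly, so deducing a zero of rho0 - s from it
    requires a bound uniform in x. The denominator |w|^2 offers no such bound at once; the conserved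
    quotient k = (|y|^2 + omega^2) / z with z = Im y does. Its level sets are the circles v^2 + (z -
    k/2)^2 = k^2/4 - omega^2, and if rho0 - s has no zero, compactness of S^1 bounds k. Uniqueness
    for the Riccati equation never divides by w. The relation y w = 2 w' is derived in
    cross-multiplied form, and since w and w' have no common zero, it shows that w cannot vanish
    while y is finite. The threshold 5/2 makes u_xx and rho_x continuous: they lie in H^(m-2) with m
    - 2 > 1/2. The embedding is used in the form |f| <= lam ||f||^2 + C / lam for all lam > 0, a
    substitute for Cauchy-Schwarz on series. *)

Lemma continuous_Rplus (f g : R -> R) (x : R) :
  continuous f x -> continuous g x -> continuous (fun y => f y + g y) x.
Proof. intros Hf Hg. exact (continuous_plus f g x Hf Hg). Qed.

Lemma continuous_Rminus (f g : R -> R) (x : R) :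
  continuous f x -> continuous g x -> continuous (fun y => f y - g y) x.
Proof. intros Hf Hg. exact (continuous_minus f g x Hf Hg). Qed.

Lemma continuous_Rmult (f g : R -> R) (x : R) :
  continuous f x -> continuous g x -> continuous (fun y => f y * g y) x.
Proof. intros Hf Hg. exact (continuous_mult f g x Hf Hg). Qed.

Lemma continuous_Rpow (f : R -> R) (n : nat) (x : R) :
  continuous f x -> continuous (fun y => f y ^ n) x.
Proof.
  intros Hf. induction n as [|n IH]; simpl.
  - apply continuous_const.
  - now apply continuous_Rmult.
Qed.

(* Matching on the shape of the function avoids costly unification. *)
Ltac continuous_step :=
  lazymatch goal with
  | |- continuous (fun _ => ?c) _ => apply continuous_const
  | |- continuous (fun x => x) _ => apply continuous_id
  | |- continuous (fun x => @?f x + @?g x) _ => apply (continuous_Rplus f g)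
  | |- continuous (fun x => @?f x - @?g x) _ => apply (continuous_Rminus f g)
  | |- continuous (fun x => @?f x * @?g x) _ => apply (continuous_Rmult f g)
  | |- continuous (fun x => @?f x ^ ?n) _ => apply (continuous_Rpow f n)
  | |- continuous (fun x => cos (@?f x)) _ =>
      apply (continuous_comp f cos); [|apply continuous_cos]
  | |- continuous (fun x => sin (@?f x)) _ =>
      apply (continuous_comp f sin); [|apply continuous_sin]
  | |- continuous ?f ?x =>
      match goal with
      | |- continuous (fun y => ?g y) ?x => progress change (continuous g x)
      | H : continuous f x |- _ => exact H
      | H : forall _, continuous f _ |- _ => apply H
      | H : forall _, continuous _ _ |- _ => apply H
      | H : forall _ _, continuous _ _ |- _ => apply H
      end
  end.

Ltac solve_continuous := intros; repeat continuous_step.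

Ltac solve_ex_RInt :=
  apply (ex_RInt_continuous (V := R_CompleteNormedModule)); intros;
  solve_continuous.

(* RInt equations live in the carrier of a canonical structure, which hides R from ring. *)
Ltac Req := match goal with |- ?a = ?b => change (@eq R a b) end.

Lemma continuous_shift (f : R -> R) (a : R) :
  (forall x, continuous f x) -> forall x, continuous (fun y => f (a + y)) x.
Proof.
  intros Hf x. apply (continuous_comp (fun y => a + y) f).
  - solve_continuous.
  - apply Hf.
Qed.

Lemma continuous_eps (f : R -> R) (x : R) :
  continuous f x <->
  forall eps, 0 < eps -> exists eta, 0 < eta /\
    forall y, Rabs (y - x) < eta -> Rabs (f y - f x) < eps.
Proof.
  split.
  - intros Hf eps Heps.
    apply filterlim_locally with (eps := mkposreal eps Heps) in Hf.
    destruct Hf as [eta Heta]. exists eta. split; [apply cond_pos|].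
    intros y Hy. exact (Heta y Hy).
  - intros H. apply filterlim_locally. intros eps.
    destruct (H eps (cond_pos eps)) as [eta [Heta Hy]].
    exists (mkposreal eta Heta). intros y Hyx. exact (Hy y Hyx).
Qed.

Lemma periodic_IZR (f : R -> R) :
  (forall x, f (x + 1) = f x) -> forall (z : Z) x, f (x + IZR z) = f x.
Proof.
  intros Hf z.
  assert (Hn : forall n : nat, forall x, f (x + INR n) = f x).
  { induction n as [|n IH]; intros x.
    - simpl. now rewrite Rplus_0_r.
    - rewrite S_INR, <- Rplus_assoc, Hf. apply IH. }
  destruct (Z_le_gt_dec 0 z) as [Hz|Hz]; intros x.
  - rewrite <- (Z2Nat.id z Hz), <- INR_IZR_INZ. apply Hn.
  - rewrite <- (Hn (Z.to_nat (- z)) (x + IZR z)), INR_IZR_INZ, Z2Nat.id by lia.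
    rewrite opp_IZR. f_equal. ring.
Qed.

Lemma representative_mod_1 (x : R) : exists z : Z, 0 <= x + IZR z <= 1.
Proof.
  exists (- (up x - 1))%Z.
  rewrite opp_IZR, minus_IZR. destruct (archimed x). lra.
Qed.

Lemma periodic_bounded (f : R -> R) :
  (forall x, f (x + 1) = f x) -> (forall x, continuous f x) ->
  exists M, 0 < M /\ forall x, Rabs (f x) <= M.
Proof.
  intros Hp Hc.
  destruct (continuity_ab_maj (fun x => Rabs (f x)) 0 1) as [y [Hy _]].
  - lra.
  - intros c _. apply continuity_pt_filterlim.
    apply (continuous_comp f Rabs); [apply Hc | apply continuous_Rabs].
  - exists (Rabs (f y) + 1). split.
    + generalize (Rabs_pos (f y)). lra.
    + intros x. destruct (representative_mod_1 x) as [z Hz].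
      rewrite <- (periodic_IZR f Hp z x). specialize (Hy _ Hz). simpl in Hy. lra.
Qed.

(** The integrals over [a, a+1] and [0, 1] differ by the one over [1, a+1] minus the one over
    [0, a], which agree by periodicity. Integrals are signed, so [a] may be any real. *)
Lemma RInt_periodic_shift (g : R -> R) :
  (forall x, g (x + 1) = g x) -> (forall x, continuous g x) ->
  forall a, RInt (fun t => g (a + t)) 0 1 = RInt g 0 1.
Proof.
  intros Hp Hc a.
  assert (E : forall a b, ex_RInt g a b) by (intros; solve_ex_RInt).
  assert (Hs : RInt (fun t => g (a + t)) 0 1 = RInt g a (a + 1)).
  { generalize (RInt_comp_lin (V := R_CompleteNormedModule) g 1 a 0 1 (E _ _)).
    replace (1 * 0 + a) with a by ring. replace (1 * 1 + a) with (a + 1) by ring.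
    intros <-. apply RInt_ext. intros x _.
    unfold scal; simpl; unfold mult; simpl. rewrite Rmult_1_l. f_equal. ring. }
  assert (Hs1 : RInt g 1 (a + 1) = RInt g 0 a).
  { generalize (RInt_comp_lin (V := R_CompleteNormedModule) g 1 1 0 a (E _ _)).
    replace (1 * 0 + 1) with 1 by ring. replace (1 * a + 1) with (a + 1) by ring.
    intros <-. apply RInt_ext. intros x _.
    unfold scal; simpl; unfold mult; simpl. rewrite !Rmult_1_l. apply Hp. }
  rewrite Hs.
  generalize (RInt_Chasles (V := R_CompleteNormedModule) g 0 a (a + 1) (E _ _) (E _ _))
    (RInt_Chasles (V := R_CompleteNormedModule) g 0 1 (a + 1) (E _ _) (E _ _)).
  unfold plus; simpl. rewrite Hs1. lra.
Qed.

Lemma cos_periodic_nat (n : nat) (x : R) :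
  cos (2 * PI * INR n * (x + 1)) = cos (2 * PI * INR n * x).
Proof.
  replace (2 * PI * INR n * (x + 1)) with (2 * PI * INR n * x + 2 * INR n * PI) by ring.
  apply cos_period.
Qed.

Lemma sin_periodic_nat (n : nat) (x : R) :
  sin (2 * PI * INR n * (x + 1)) = sin (2 * PI * INR n * x).
Proof.
  replace (2 * PI * INR n * (x + 1)) with (2 * PI * INR n * x + 2 * INR n * PI) by ring.
  apply sin_period.
Qed.

(** * Dirichlet and Fejer kernels *)

Definition fourier_cos (f : R -> R) (n : nat) : R :=
  RInt (fun x => f x * cos (2 * PI * INR n * x)) 0 1.

Definition fourier_sin (f : R -> R) (n : nat) : R :=
  RInt (fun x => f x * sin (2 * PI * INR n * x)) 0 1.

(* The frequencies n and -n are merged, whence the factor 2 for n > 0. *)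
Definition weight (n : nat) : R := match n with 0%nat => 1 | _ => 2 end.

Definition mode (f : R -> R) (n : nat) (x : R) : R :=
  weight n * (fourier_cos f n * cos (2 * PI * INR n * x)
              + fourier_sin f n * sin (2 * PI * INR n * x)).

Definition dirichlet (k : nat) (t : R) : R :=
  sum_f_R0 (fun n => weight n * cos (2 * PI * INR n * t)) k.

(** N + 1 times the usual Fejer kernel: leaving out the normalization postpones all division to
    [fourier_inversion]. *)
Definition fejer (N : nat) (t : R) : R := sum_f_R0 (fun k => dirichlet k t) N.

Lemma continuous_sum_f_R0 (u : nat -> R -> R) (n : nat) (x : R) :
  (forall k, continuous (u k) x) ->
  continuous (fun t => sum_f_R0 (fun k => u k t) n) x.
Proof.
  intros Hu. induction n as [|n IH]; simpl; [apply Hu|].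
  apply continuous_Rplus; [exact IH | apply Hu].
Qed.

Lemma RInt_sum_f_R0 (u : nat -> R -> R) (n : nat) (a b : R) :
  (forall k x, continuous (u k) x) ->
  RInt (fun t => sum_f_R0 (fun k => u k t) n) a b
  = sum_f_R0 (fun k => RInt (u k) a b) n.
Proof.
  intros Hu. induction n as [|n IH]; simpl; [reflexivity|].
  rewrite <- IH.
  apply (RInt_plus (V := R_CompleteNormedModule)
           (fun t => sum_f_R0 (fun k => u k t) n) (u (S n)));
    apply (ex_RInt_continuous (V := R_CompleteNormedModule)); intros.
  - apply continuous_sum_f_R0. intros k. apply Hu.
  - apply Hu.
Qed.

Lemma continuous_dirichlet (k : nat) (x : R) : continuous (dirichlet k) x.
Proof.
  unfold dirichlet.
  apply (continuous_sum_f_R0 (fun n t => weight n * cos (2 * PI * INR n * t))).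
  intros n. solve_continuous.
Qed.

Lemma continuous_fejer (k : nat) (x : R) : continuous (fejer k) x.
Proof. apply continuous_sum_f_R0. intros n. apply continuous_dirichlet. Qed.

Lemma RInt_Rscal (f : R -> R) (l a b : R) :
  (forall x, continuous f x) ->
  RInt (fun x => l * f x) a b = l * RInt f a b.
Proof.
  intros Hf. apply (RInt_scal (V := R_CompleteNormedModule) f). solve_ex_RInt.
Qed.

Lemma RInt_Rplus (f g : R -> R) (a b : R) :
  (forall x, continuous f x) -> (forall x, continuous g x) ->
  RInt (fun x => f x + g x) a b = RInt f a b + RInt g a b.
Proof.
  intros Hf Hg.
  apply (RInt_plus (V := R_CompleteNormedModule) f g); solve_ex_RInt.
Qed.

Lemma RInt_Rminus (f g : R -> R) (a b : R) :
  (forall x, continuous f x) -> (forall x, continuous g x) ->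
  RInt (fun x => f x - g x) a b = RInt f a b - RInt g a b.
Proof.
  intros Hf Hg.
  apply (RInt_minus (V := R_CompleteNormedModule) f g); solve_ex_RInt.
Qed.

(** With y = x + t, cos (2 PI n t) = cos (2 PI n y - 2 PI n x) splits by the addition formula, and a
    period may be translated. *)
Lemma RInt_shift_mode (f : R -> R) (n : nat) (x : R) :
  (forall x, f (x + 1) = f x) -> (forall x, continuous f x) ->
  RInt (fun t => f (x + t) * (weight n * cos (2 * PI * INR n * t))) 0 1
  = mode f n x.
Proof.
  intros Hp Hc.
  set (g := fun y => weight n * cos (2 * PI * INR n * x)
                       * (f y * cos (2 * PI * INR n * y))
                     + weight n * sin (2 * PI * INR n * x)
                       * (f y * sin (2 * PI * INR n * y))).
  rewrite (RInt_ext _ (fun t => g (x + t))).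
  - rewrite (RInt_periodic_shift g).
    + unfold g. rewrite RInt_Rplus, !RInt_Rscal by solve_continuous.
      unfold mode, fourier_cos, fourier_sin. Req. ring.
    + intros y. unfold g. now rewrite Hp, cos_periodic_nat, sin_periodic_nat.
    + intros y. unfold g. solve_continuous.
  - intros t _. unfold g.
    replace (2 * PI * INR n * t)
      with (2 * PI * INR n * (x + t) - 2 * PI * INR n * x) by ring.
    rewrite cos_minus. Req. ring.
Qed.

Lemma RInt_shift_dirichlet (f : R -> R) (k : nat) (x : R) :
  (forall x, f (x + 1) = f x) -> (forall x, continuous f x) ->
  RInt (fun t => f (x + t) * dirichlet k t) 0 1
  = sum_f_R0 (fun n => mode f n x) k.
Proof.
  intros Hp Hc.
  assert (Hs := continuous_shift f x Hc).
  rewrite (RInt_ext _ (fun t =>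
     sum_f_R0 (fun n => f (x + t) * (weight n * cos (2 * PI * INR n * t))) k)).
  - rewrite (RInt_sum_f_R0 (fun n t => f (x + t) * (weight n * cos (2 * PI * INR n * t))))
      by solve_continuous.
    apply sum_eq. intros n _. now apply RInt_shift_mode.
  - intros t _. unfold dirichlet. rewrite scal_sum. apply sum_eq. intros; ring.
Qed.

Lemma RInt_shift_fejer (f : R -> R) (N : nat) (x : R) :
  (forall x, f (x + 1) = f x) -> (forall x, continuous f x) ->
  RInt (fun t => f (x + t) * fejer N t) 0 1
  = sum_f_R0 (fun k => sum_f_R0 (fun n => mode f n x) k) N.
Proof.
  intros Hp Hc.
  assert (Hs := continuous_shift f x Hc).
  rewrite (RInt_ext _ (fun t => sum_f_R0 (fun k => f (x + t) * dirichlet k t) N)).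
  - rewrite (RInt_sum_f_R0 (fun k t => f (x + t) * dirichlet k t)).
    + apply sum_eq. intros k _. now apply RInt_shift_dirichlet.
    + intros k t. apply continuous_Rmult; [apply Hs | apply continuous_dirichlet].
  - intros t _. unfold fejer. rewrite scal_sum. apply sum_eq. intros; ring.
Qed.

Lemma RInt_cos_nat (n : nat) :
  (0 < n)%nat -> RInt (fun t => cos (2 * PI * INR n * t)) 0 1 = 0.
Proof.
  intros Hn. assert (Hn' := lt_0_INR n Hn). assert (HPI := PI_RGT_0).
  apply is_RInt_unique.
  replace 0 with (minus (sin (2 * PI * INR n * 1) / (2 * PI * INR n))
                    (sin (2 * PI * INR n * 0) / (2 * PI * INR n))) at 2.
  - apply (is_RInt_derive (fun t => sin (2 * PI * INR n * t) / (2 * PI * INR n))).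
    + intros x _. auto_derive; [trivial|]. field. lra.
    + solve_continuous.
  - replace (2 * PI * INR n * 1) with (0 + 2 * INR n * PI) by ring.
    rewrite sin_period, Rmult_0_r, sin_0. unfold minus, plus, opp; simpl. lra.
Qed.

Lemma RInt_dirichlet (k : nat) : RInt (dirichlet k) 0 1 = 1.
Proof.
  unfold dirichlet.
  rewrite (RInt_sum_f_R0 (fun n t => weight n * cos (2 * PI * INR n * t)))
    by solve_continuous.
  induction k as [|k IH].
  - simpl. rewrite (RInt_ext _ (fun _ => 1)).
    + rewrite RInt_const. unfold scal; simpl; unfold mult; simpl. Req. ring.
    + intros x _. rewrite Rmult_0_r, Rmult_0_l, cos_0. apply Rmult_1_l.
  - rewrite tech5, IH, RInt_Rscal, RInt_cos_nat by (lia || solve_continuous). lra.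
Qed.

Lemma RInt_fejer (N : nat) : RInt (fejer N) 0 1 = INR (S N).
Proof.
  unfold fejer. rewrite RInt_sum_f_R0 by apply continuous_dirichlet.
  induction N as [|N IH]; [apply RInt_dirichlet|].
  rewrite tech5, IH, RInt_dirichlet, (S_INR (S N)). reflexivity.
Qed.

(** Telescoping with y = PI t: 2 sin y cos ((2k+2) y) = sin ((2k+3) y) - sin ((2k+1) y). *)
Lemma sin_dirichlet (k : nat) (t : R) :
  sin (PI * t) * dirichlet k t = sin ((2 * INR k + 1) * (PI * t)).
Proof.
  induction k as [|k IH].
  - unfold dirichlet; simpl. rewrite Rmult_0_r, !Rmult_0_l, cos_0.
    replace ((2 * 0 + 1) * (PI * t)) with (PI * t) by ring. ring.
  - unfold dirichlet in *. rewrite tech5, Rmult_plus_distr_l, IH, S_INR.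
    simpl weight. set (y := PI * t).
    replace (2 * PI * (INR k + 1) * t) with ((2 * INR k + 2) * y)
      by (unfold y; ring).
    replace ((2 * INR k + 1) * y) with ((2 * INR k + 2) * y - y) by ring.
    replace ((2 * (INR k + 1) + 1) * y) with ((2 * INR k + 2) * y + y) by ring.
    rewrite sin_minus, sin_plus. ring.
Qed.

(** Telescoping again: sin^2 (a + y) - sin^2 a = sin y sin (2a + y), here with a = (N+1) y in the
    step from N to N + 1. *)
Lemma sin_sq_fejer (N : nat) (t : R) :
  sin (PI * t) ^ 2 * fejer N t = sin (INR (S N) * (PI * t)) ^ 2.
Proof.
  set (y := PI * t).
  induction N as [|N IH].
  - unfold fejer, dirichlet; simpl.
    rewrite Rmult_0_r, !Rmult_0_l, cos_0, !Rmult_1_l, !Rmult_1_r. reflexivity.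
  - unfold fejer in *. rewrite tech5, Rmult_plus_distr_l, IH.
    replace (sin y ^ 2 * dirichlet (S N) t)
      with (sin y * (sin y * dirichlet (S N) t)) by ring.
    unfold y at 3 4. rewrite sin_dirichlet. fold y.
    rewrite (S_INR (S N)). set (a := INR (S N) * y).
    replace ((2 * INR (S N) + 1) * y) with (a + (a + y)) by (unfold a; ring).
    replace ((INR (S N) + 1) * y) with (a + y) by (unfold a; ring).
    rewrite (sin_plus a (a + y)), sin_plus, cos_plus.
    generalize (sin2_cos2 a) (sin2_cos2 y). unfold Rsqr. intros Ha Hy.
    replace (sin a ^ 2) with (sin a ^ 2 * (sin y * sin y + cos y * cos y))
      by (rewrite Hy; ring).
    ring_simplify.
    assert (E : sin y ^ 2 = sin y ^ 2 * (sin a * sin a + cos a * cos a))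
      by (rewrite Ha; ring).
    nra.
Qed.

Lemma fejer_pos (N : nat) (t : R) : 0 < t < 1 -> 0 <= fejer N t.
Proof.
  intros Ht. assert (HPI := PI_RGT_0).
  assert (Hs : 0 < sin (PI * t)) by (apply sin_gt_0; nra).
  assert (E := sin_sq_fejer N t). assert (Hp := pow2_ge_0 (sin (INR (S N) * (PI * t)))).
  assert (H2 : 0 < sin (PI * t) ^ 2) by nra. nra.
Qed.

(* Away from t = 0 and t = 1 the oscillation of f is absorbed by sin^2, and
   sin^2 (PI t) fejer N t is bounded uniformly in N. *)
Lemma oscillation_bound (f : R -> R) (x eps : R) :
  (forall x, f (x + 1) = f x) -> (forall x, continuous f x) -> 0 < eps ->
  exists C, forall t, 0 < t < 1 ->
    Rabs (f (x + t) - f x) <= eps + C * sin (PI * t) ^ 2.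
Proof.
  intros Hp Hc Heps. assert (HPI := PI_RGT_0).
  destruct (periodic_bounded f Hp Hc) as [M [HM HfM]].
  destruct (proj1 (continuous_eps f x) (Hc x) eps Heps) as [eta0 [Heta0 Hf]].
  set (eta := Rmin eta0 (1 / 2)).
  assert (He1 : eta <= eta0) by apply Rmin_l.
  assert (He2 : eta <= 1 / 2) by apply Rmin_r.
  assert (He : 0 < eta) by (unfold eta; apply Rmin_glb_lt; lra).
  assert (Hs : 0 < sin (PI * eta)) by (apply sin_gt_0; nra).
  assert (Hs2 : 0 < sin (PI * eta) ^ 2) by nra.
  (* For t in [eta, 1 - eta], sin (PI t) is at least sin (PI eta), so this constant absorbs the
     trivial bound 2 M. For the remaining t, x + t is within eta of x modulo 1. *)
  exists (2 * M / sin (PI * eta) ^ 2). intros t Ht.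
  assert (HC : 0 < 2 * M / sin (PI * eta) ^ 2) by (apply Rdiv_lt_0_compat; lra).
  assert (Hq : 0 <= 2 * M / sin (PI * eta) ^ 2 * sin (PI * t) ^ 2)
    by (apply Rmult_le_pos; [lra | apply pow2_ge_0]).
  destruct (Rlt_le_dec t eta) as [H1|H1].
  - enough (Rabs (f (x + t) - f x) < eps) by lra.
    apply Hf. rewrite Rabs_pos_eq; lra.
  - destruct (Rlt_le_dec (1 - eta) t) as [H2|H2].
    + enough (Rabs (f (x + t) - f x) < eps) by lra.
      replace (x + t) with ((x + t - 1) + 1) by ring. rewrite Hp.
      apply Hf. rewrite Rabs_left; lra.
    + assert (H3 : sin (PI * eta) <= sin (PI * t)).
      { destruct (Rle_lt_dec t (1 / 2)) as [H3|H3].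
        - apply sin_incr_1; nra.
        - rewrite <- (sin_PI_x (PI * t)).
          apply sin_incr_1; nra. }
      assert (H4 : sin (PI * eta) ^ 2 <= sin (PI * t) ^ 2) by nra.
      assert (H5 : 2 * M <= 2 * M / sin (PI * eta) ^ 2 * sin (PI * t) ^ 2).
      { replace (2 * M) with (2 * M / sin (PI * eta) ^ 2 * sin (PI * eta) ^ 2) at 1
          by (field; lra).
        apply Rmult_le_compat_l; lra. }
      assert (H6 := Rabs_triang (f (x + t)) (- f x)). rewrite Rabs_Ropp in H6.
      generalize (HfM (x + t)) (HfM x). unfold Rminus. lra.
Qed.

(** [C] is independent of N, so division by N + 1 leaves an error eps + C / (N+1). The kernel is
    nonnegative with integral N + 1, and it turns the sin^2 term of [oscillation_bound] into a
    bounded one. *)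
Lemma fejer_mean_bound (f : R -> R) (x eps : R) :
  (forall x, f (x + 1) = f x) -> (forall x, continuous f x) -> 0 < eps ->
  exists C, forall N,
    Rabs (sum_f_R0 (fun k => sum_f_R0 (fun n => mode f n x) k) N - f x * INR (S N))
    <= eps * INR (S N) + C.
Proof.
  intros Hp Hc Heps.
  destruct (oscillation_bound f x eps Hp Hc Heps) as [C HC].
  exists (Rabs C). intros N.
  assert (Hs := continuous_shift f x Hc).
  assert (HF := continuous_fejer N).
  rewrite <- RInt_shift_fejer, <- RInt_fejer by assumption.
  rewrite <- RInt_Rscal by assumption.
  rewrite <- RInt_Rminus by solve_continuous.
  assert (E : eps * RInt (fejer N) 0 1 + Rabs C
    = RInt (fun t => eps * fejer N t + Rabs C) 0 1).
  { rewrite RInt_Rplus, RInt_Rscal, RInt_const by solve_continuous.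
    unfold scal; simpl; unfold mult; simpl. Req. ring. }
  rewrite E.
  eapply Rle_trans; [apply abs_RInt_le; [lra | solve_ex_RInt]|].
  apply RInt_le; [lra | | solve_ex_RInt |].
  - apply (ex_RInt_continuous (V := R_CompleteNormedModule)). intros z _.
    apply (continuous_comp (fun t => f (x + t) * fejer N t - f x * fejer N t) Rabs);
      [solve_continuous | apply continuous_Rabs].
  - intros t Ht.
    replace (f (x + t) * fejer N t - f x * fejer N t)
      with ((f (x + t) - f x) * fejer N t) by ring.
    assert (HFp := fejer_pos N t Ht).
    rewrite Rabs_mult, (Rabs_pos_eq (fejer N t)) by assumption.
    apply Rle_trans with ((eps + C * sin (PI * t) ^ 2) * fejer N t).
    + apply Rmult_le_compat_r; auto.
    + rewrite Rmult_plus_distr_r, Rmult_assoc, sin_sq_fejer.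
      apply Rplus_le_compat_l.
      generalize (SIN_bound (INR (S N) * (PI * t))) (Rle_abs C) (Rabs_pos C).
      set (y := sin _). intros Hy H1 H2.
      assert (0 <= y ^ 2 <= 1) by nra. nra.
Qed.

(** A convergent series has Cesaro means with the same limit, and the Cesaro means tend to f x by
    the Fejer bound. *)
Theorem fourier_inversion (f : R -> R) (x l : R) :
  (forall x, f (x + 1) = f x) -> (forall x, continuous f x) ->
  is_series (fun n => mode f n x) l -> l = f x.
Proof.
  intros Hp Hc Hl.
  apply is_series_Reals in Hl.
  assert (H1 : Un_cv (sum_f_R0 (fun n => mode f n x)) l) by exact Hl.
  apply Cesaro_1 in H1.
  apply (UL_sequence _ _ _ H1). intros eps Heps.
  destruct (fejer_mean_bound f x (eps / 2) Hp Hc ltac:(lra)) as [C HC].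
  destruct (INR_unbounded (2 * C / eps)) as [n0 Hn0].
  (* The n-th mean divides the sum up to [pred n] by n, so it is the Fejer mean of index n - 1;
     beyond [n0] the remainder C / n is below eps / 2. *)
  exists (S n0). intros n Hn. destruct n as [|n]; [lia|].
  simpl pred. unfold R_dist. specialize (HC n).
  assert (Hpos : 0 < INR (S n)) by (apply lt_0_INR; lia).
  set (A := sum_f_R0 _ n) in *.
  replace (A / INR (S n) - f x) with ((A - f x * INR (S n)) / INR (S n))
    by (field; lra).
  unfold Rdiv. rewrite Rabs_mult, Rabs_inv, (Rabs_pos_eq (INR (S n))) by lra.
  apply Rmult_lt_reg_r with (INR (S n)); [assumption|].
  rewrite Rmult_assoc, Rinv_l, Rmult_1_r by lra.
  assert (Hn' : INR n0 < INR (S n)) by (apply lt_INR; lia).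
  assert (H2 : 2 * C < eps * INR (S n)).
  { apply Rmult_lt_reg_r with (/ eps); [now apply Rinv_0_lt_compat|].
    replace (eps * INR (S n) * / eps) with (INR (S n)) by (field; lra).
    unfold Rdiv in Hn0. lra. }
  lra.
Qed.

(** * Sobolev embedding *)

Lemma ex_series_bounded (a : nat -> R) (B : R) :
  (forall n, 0 <= a n) -> (forall n, sum_f_R0 a n <= B) -> ex_series a.
Proof.
  intros Ha HB.
  destruct (ex_finite_lim_seq_incr (sum_f_R0 a) B) as [l Hl].
  - intros n. simpl. specialize (Ha (S n)). lra.
  - exact HB.
  - exists l. apply is_series_Reals. apply is_lim_seq_Reals in Hl. exact Hl.
Qed.

(** Integral comparison for r^(-p-1) on [x, x+1] in elementary form: it follows from 1 / (x+1) <= ln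
    (x+1) - ln x and 1 + h <= exp h. *)
Lemma Rpower_telescope (p x : R) :
  0 < p -> 0 < x ->
  p * Rpower (x + 1) (- p - 1) <= Rpower x (- p) - Rpower (x + 1) (- p).
Proof.
  intros Hp Hx.
  assert (H1 : Rpower (x + 1) (- p - 1) = Rpower (x + 1) (- p) * / (x + 1)).
  { unfold Rminus. rewrite Rpower_plus, (Rpower_Ropp _ 1), Rpower_1 by lra.
    reflexivity. }
  assert (H2 : Rpower x (- p)
    = Rpower (x + 1) (- p) * exp (p * (ln (x + 1) - ln x))).
  { unfold Rpower. rewrite <- exp_plus. f_equal. ring. }
  assert (H3 : / (x + 1) <= ln (x + 1) - ln x).
  { assert (H := exp_ineq1_le (ln x - ln (x + 1))).
    unfold Rminus in H. rewrite exp_plus, exp_Ropp, !exp_ln in H by lra.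
    replace (x * / (x + 1)) with (1 - / (x + 1)) in H by (field; lra). lra. }
  assert (H4 := exp_ineq1_le (p * (ln (x + 1) - ln x))).
  assert (H5 : 0 < Rpower (x + 1) (- p)) by apply exp_pos.
  rewrite H1, H2.
  apply Rle_trans with (Rpower (x + 1) (- p) * (p * (ln (x + 1) - ln x))).
  - replace (p * (Rpower (x + 1) (- p) * / (x + 1)))
      with (Rpower (x + 1) (- p) * (p * / (x + 1))) by ring.
    apply Rmult_le_compat_l; [lra|]. apply Rmult_le_compat_l; lra.
  - nra.
Qed.

Lemma ex_series_sobolev_weight (m : R) :
  1 / 2 < m -> ex_series (fun n => Rpower (1 + INR n ^ 2) (- m)).
Proof.
  intros Hm. set (p := 2 * m - 1). assert (Hp : 0 < p) by (unfold p; lra).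
  (* From (x+1)^2 <= 2 (1 + x^2) one gets (1 + x^2)^(-m) <= 2^m (x+1)^(-2m), and 2 m = p + 1. *)
  set (C := Rpower 2 m). assert (HC : 0 < C) by apply exp_pos.
  apply ex_series_incr_1.
  apply ex_series_bounded with (C / p).
  - intros n. apply Rlt_le, exp_pos.
  - assert (Ht : forall n, Rpower (1 + INR (S n) ^ 2) (- m)
      <= C / p * (Rpower (INR (S n)) (- p) - Rpower (INR (S (S n))) (- p))).
    { intros n. assert (Hn : 0 < INR (S n)) by (apply lt_0_INR; lia).
      assert (H := Rpower_telescope p (INR (S n)) Hp Hn).
      rewrite (S_INR (S n)). set (x := INR (S n)) in *.
      apply Rle_trans with (C * Rpower (x + 1) (- p - 1)).
      - unfold C, Rpower. rewrite <- exp_plus.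
        assert (Hl : 2 * ln (x + 1) <= ln 2 + ln (1 + x ^ 2)).
        { rewrite <- ln_mult by nra.
          replace (2 * ln (x + 1)) with (ln (x + 1) + ln (x + 1)) by ring.
          rewrite <- ln_mult by lra. assert (Hq := pow2_ge_0 (x - 1)).
          apply ln_le; [apply Rmult_lt_0_compat; lra | lra]. }
        assert (He : - m * ln (1 + x ^ 2) <= m * ln 2 + (- p - 1) * ln (x + 1)).
        { unfold p. nra. }
        destruct He as [He|He]; [left; now apply exp_increasing | right; now rewrite He].
      - replace (C * Rpower (x + 1) (- p - 1))
          with (C / p * (p * Rpower (x + 1) (- p - 1))) by (field; lra).
        apply Rmult_le_compat_l; [apply Rlt_le, Rdiv_lt_0_compat; lra | exact H]. }
    assert (Hs : forall n, sum_f_R0 (fun k => Rpower (1 + INR (S k) ^ 2) (- m)) n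
      <= C / p * (1 - Rpower (INR (S (S n))) (- p))).
    { induction n as [|n IH].
      - generalize (Ht 0%nat). simpl sum_f_R0.
        replace (Rpower (INR 1) (- p)) with 1; [tauto|].
        unfold Rpower. simpl. now rewrite ln_1, Rmult_0_r, exp_0.
      - rewrite tech5. generalize (Ht (S n)). lra. }
    intros n. eapply Rle_trans; [apply Hs|].
    assert (0 < C / p) by (apply Rdiv_lt_0_compat; lra).
    assert (0 < Rpower (INR (S (S n))) (- p)) by apply exp_pos. nra.
Qed.

(** Expand (lam A sqrt q - 1)^2 >= 0 and divide by lam A. The free [lam] lets one of the two terms
    be made small at the expense of the other. *)
Lemma two_sqrt_le (A q lam : R) :
  0 < A -> 0 <= q -> 0 < lam -> 2 * sqrt q <= lam * (A * q) + / lam * / A.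
Proof.
  intros HA Hq Hl.
  assert (H := pow2_ge_0 (lam * A * sqrt q - 1)).
  assert (Hs := sqrt_sqrt q Hq).
  assert (H1 : 0 <= / (lam * A) * (lam * A * sqrt q - 1) ^ 2).
  { apply Rmult_le_pos; [apply Rlt_le, Rinv_0_lt_compat; nra | exact H]. }
  replace (/ (lam * A) * (lam * A * sqrt q - 1) ^ 2)
    with (lam * A * (sqrt q * sqrt q) - 2 * sqrt q + / lam * / A) in H1
    by (field; lra).
  rewrite Hs in H1. lra.
Qed.

Lemma sobolev_sqrt_bound (m lam : R) (q : nat -> R) (n : nat) :
  (forall n, 0 <= q n) -> 0 < lam ->
  2 * sqrt (q n) <= lam * (Rpower (1 + INR n ^ 2) m * q n)
                    + / lam * Rpower (1 + INR n ^ 2) (- m).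
Proof.
  intros Hq Hl. rewrite Rpower_Ropp.
  apply two_sqrt_le; [apply exp_pos | apply Hq | exact Hl].
Qed.

Lemma ex_series_Rle (a b : nat -> R) :
  (forall n, 0 <= a n <= b n) -> ex_series b -> ex_series a.
Proof.
  intros H. apply (ex_series_le (K := R_AbsRing) (V := R_CompleteNormedModule)).
  intros n. change (Rabs (a n) <= b n). rewrite Rabs_pos_eq; apply H.
Qed.

Lemma ex_series_Rscal (c : R) (a : nat -> R) :
  ex_series a -> ex_series (fun n => c * a n).
Proof. apply (ex_series_scal (K := R_AbsRing) c a). Qed.

Lemma ex_series_Rplus (a b : nat -> R) :
  ex_series a -> ex_series b -> ex_series (fun n => a n + b n).
Proof. apply (ex_series_plus (K := R_AbsRing) (V := R_NormedModule) a b). Qed.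

Lemma ex_series_sqrt (m : R) (q : nat -> R) :
  1 / 2 < m -> (forall n, 0 <= q n) ->
  ex_series (fun n => Rpower (1 + INR n ^ 2) m * q n) ->
  ex_series (fun n => 2 * sqrt (q n)).
Proof.
  intros Hm Hq Hs.
  apply ex_series_Rle with (fun n => 1 * (Rpower (1 + INR n ^ 2) m * q n)
                    + / 1 * Rpower (1 + INR n ^ 2) (- m)).
  - intros n. split; [generalize (sqrt_pos (q n)); lra|].
    apply sobolev_sqrt_bound; [exact Hq | lra].
  - apply ex_series_Rplus; apply ex_series_Rscal; [exact Hs|].
    now apply ex_series_sobolev_weight.
Qed.

Lemma fourier_sq_pos (f : R -> R) (n : nat) : 0 <= fourier_sq f n.
Proof. unfold fourier_sq. apply Rplus_le_le_0_compat; apply pow2_ge_0. Qed.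

Lemma trig_combination_bound (a b t : R) :
  Rabs (a * cos t + b * sin t) <= sqrt (a ^ 2 + b ^ 2).
Proof.
  rewrite <- sqrt_Rsqr_abs. apply sqrt_le_1_alt.
  assert (H := sin2_cos2 t). unfold Rsqr in *.
  assert (H1 := pow2_ge_0 (a * sin t - b * cos t)).
  replace (a ^ 2 + b ^ 2)
    with ((a ^ 2 + b ^ 2) * (sin t * sin t + cos t * cos t)) by (rewrite H; ring).
  nra.
Qed.

Lemma weight_bound (n : nat) : 0 <= weight n <= 2.
Proof. destruct n; simpl; lra. Qed.

Lemma mode_bound (f : R -> R) (n : nat) (x : R) :
  Rabs (mode f n x) <= 2 * sqrt (fourier_sq f n).
Proof.
  unfold mode. rewrite Rabs_mult, Rabs_pos_eq by apply weight_bound.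
  apply Rmult_le_compat; try apply weight_bound; [apply Rabs_pos|].
  apply trig_combination_bound.
Qed.

Lemma sobolev_mode_series (m : R) (f : R -> R) (x : R) :
  1 / 2 < m -> sobolev m f -> is_series (fun n => mode f n x) (f x).
Proof.
  intros Hm [Hp [Hc Hs]].
  assert (He : ex_series (fun n => mode f n x)).
  { apply (ex_series_le (K := R_AbsRing) (V := R_CompleteNormedModule) _
             (fun n => 2 * sqrt (fourier_sq f n))).
    - intros n. apply mode_bound.
    - apply ex_series_sqrt with m; auto using fourier_sq_pos. }
  destruct He as [l Hl].
  now rewrite <- (fourier_inversion f x l Hp Hc Hl).
Qed.

Lemma sobolev_norm_sq (m : R) (f : R -> R) :
  ex_series (sobolev_term m f) ->
  sobolev_norm m f ^ 2 = Series (sobolev_term m f).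
Proof.
  intros Hs. unfold sobolev_norm. apply pow2_sqrt.
  rewrite <- (Rmult_0_l (Series (sobolev_term m f))), <- Series_scal_l.
  apply Series_le; [|exact Hs].
  intros n. rewrite Rmult_0_l. split; [lra|]. apply Rmult_le_pos; [apply Rlt_le, exp_pos|].
  apply fourier_sq_pos.
Qed.

(** Sum the modewise bound over the Fourier series. Optimizing in [lam] would give the usual
    multiple of the norm; the linear form suffices for passing from norm to uniform convergence. *)
Lemma sobolev_sup_bound (m lam : R) (f : R -> R) (x : R) :
  1 / 2 < m -> sobolev m f -> 0 < lam ->
  Rabs (f x) <= lam * sobolev_norm m f ^ 2
                + / lam * Series (fun n => Rpower (1 + INR n ^ 2) (- m)).
Proof.
  intros Hm Hf Hl.
  rewrite <- (is_series_unique _ _ (sobolev_mode_series m f x Hm Hf)).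
  destruct Hf as [Hp [Hc Hs]].
  rewrite sobolev_norm_sq by exact Hs.
  assert (Hw := ex_series_sobolev_weight m Hm).
  rewrite <- !Series_scal_l.
  rewrite <- Series_plus by (apply ex_series_Rscal; assumption).
  assert (He : ex_series (fun n => lam * sobolev_term m f n
                 + / lam * Rpower (1 + INR n ^ 2) (- m)))
    by (apply ex_series_Rplus; apply ex_series_Rscal; assumption).
  assert (Hb : forall n, Rabs (mode f n x) <= lam * sobolev_term m f n
                 + / lam * Rpower (1 + INR n ^ 2) (- m)).
  { intros n. eapply Rle_trans; [apply mode_bound|].
    apply sobolev_sqrt_bound; auto using fourier_sq_pos. }
  eapply Rle_trans; [apply Series_Rabs|].
  - apply ex_series_Rle with (2 := He). intros n. split; [apply Rabs_pos | apply Hb].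
  - apply Series_le; [|exact He]. intros n. split; [apply Rabs_pos | apply Hb].
Qed.

Lemma fourier_sq_minus (f g : R -> R) (n : nat) :
  (forall x, continuous f x) -> (forall x, continuous g x) ->
  fourier_sq (fun x => f x - g x) n <= 2 * fourier_sq f n + 2 * fourier_sq g n.
Proof.
  intros Hf Hg. unfold fourier_sq.
  rewrite (RInt_ext (fun x => (f x - g x) * cos (2 * PI * INR n * x))
    (fun x => f x * cos (2 * PI * INR n * x) - g x * cos (2 * PI * INR n * x)))
    by (intros; Req; ring).
  rewrite (RInt_ext (fun x => (f x - g x) * sin (2 * PI * INR n * x))
    (fun x => f x * sin (2 * PI * INR n * x) - g x * sin (2 * PI * INR n * x)))
    by (intros; Req; ring).
  rewrite !RInt_Rminus by solve_continuous.
  generalize (RInt (fun x => f x * cos (2 * PI * INR n * x)) 0 1)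
    (RInt (fun x => g x * cos (2 * PI * INR n * x)) 0 1)
    (RInt (fun x => f x * sin (2 * PI * INR n * x)) 0 1)
    (RInt (fun x => g x * sin (2 * PI * INR n * x)) 0 1).
  intros a b c d. generalize (pow2_ge_0 (a + b)) (pow2_ge_0 (c + d)). lra.
Qed.

Lemma sobolev_minus (m : R) (f g : R -> R) :
  sobolev m f -> sobolev m g -> sobolev m (fun x => f x - g x).
Proof.
  intros [Hpf [Hcf Hsf]] [Hpg [Hcg Hsg]]. split; [|split].
  - intros x. now rewrite Hpf, Hpg.
  - solve_continuous.
  - apply ex_series_Rle with
      (fun n => 2 * sobolev_term m f n + 2 * sobolev_term m g n).
    + intros n. unfold sobolev_term.
      assert (H := exp_pos (m * ln (1 + INR n ^ 2))).
      change (0 < Rpower (1 + INR n ^ 2) m) in H.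
      generalize (fourier_sq_pos (fun x => f x - g x) n)
        (fourier_sq_minus f g n Hcf Hcg). nra.
    + apply ex_series_Rplus; apply ex_series_Rscal; assumption.
Qed.

(** * Termwise differentiation and derivatives in Sobolev spaces *)

Lemma Mtest_CVU (u : nat -> R -> R) (B : nat -> R) :
  (forall n x, Rabs (u n x) <= B n) -> ex_series B ->
  CVU_dom (fun n x => sum_f_R0 (fun k => u k x) n) (fun _ => True).
Proof.
  intros Hu [l Hl]. apply CVU_dom_cauchy.
  assert (Hd : forall x n k,
    Rabs (sum_f_R0 (fun k => u k x) (n + k) - sum_f_R0 (fun k => u k x) n)
    <= sum_f_R0 B (n + k) - sum_f_R0 B n).
  { intros x n k. induction k as [|k IH].
    - rewrite Nat.add_0_r, !Rminus_diag. rewrite Rabs_R0. lra.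
    - rewrite Nat.add_succ_r, !tech5.
      replace (sum_f_R0 (fun k => u k x) (n + k) + u (S (n + k)) x
               - sum_f_R0 (fun k => u k x) n)
        with ((sum_f_R0 (fun k => u k x) (n + k) - sum_f_R0 (fun k => u k x) n)
              + u (S (n + k)) x) by ring.
      eapply Rle_trans; [apply Rabs_triang|].
      specialize (Hu (S (n + k)) x). lra. }
  apply is_series_Reals in Hl.
  assert (Hc : Cauchy_crit (sum_f_R0 B)) by (apply CV_Cauchy; now exists l).
  intros eps. destruct (Hc eps (cond_pos eps)) as [N HN].
  exists N. intros n k x _ Hn Hk.
  assert (Hle : forall i j, (N <= i)%nat -> (N <= j)%nat -> (i <= j)%nat ->
    Rabs (sum_f_R0 (fun k => u k x) j - sum_f_R0 (fun k => u k x) i) < eps).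
  { intros i j Hi Hj Hij. replace j with (i + (j - i))%nat by lia.
    eapply Rle_lt_trans; [apply Hd|].
    eapply Rle_lt_trans; [apply Rle_abs|]. apply HN; lia. }
  destruct (Nat.le_ge_cases n k) as [H|H].
  - rewrite Rabs_minus_sym. now apply Hle.
  - now apply Hle.
Qed.

(** Written with [+ -] so that it has the shape a cos + b sin of [trig_combination_bound]. *)
Definition mode_derive (f : R -> R) (n : nat) (x : R) : R :=
  weight n * (2 * PI * INR n)
  * (fourier_sin f n * cos (2 * PI * INR n * x)
     + - fourier_cos f n * sin (2 * PI * INR n * x)).

Lemma is_derive_mode (f : R -> R) (n : nat) (x : R) :
  is_derive (mode f n) x (mode_derive f n x).
Proof. unfold mode, mode_derive. auto_derive; [trivial|]. ring. Qed.

Lemma mode_derive_bound (f : R -> R) (n : nat) (x : R) :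
  Rabs (mode_derive f n x) <= 2 * PI * (2 * sqrt (INR n ^ 2 * fourier_sq f n)).
Proof.
  assert (HPI := PI_RGT_0). assert (Hn := pos_INR n).
  rewrite sqrt_mult by (apply pow2_ge_0 || apply fourier_sq_pos).
  rewrite sqrt_pow2 by exact Hn.
  unfold mode_derive. rewrite Rabs_mult.
  assert (Hw := weight_bound n).
  rewrite (Rabs_pos_eq (weight n * _)) by (apply Rmult_le_pos; nra).
  replace (2 * PI * (2 * (INR n * sqrt (fourier_sq f n))))
    with (2 * (2 * PI * INR n) * sqrt (fourier_sq f n)) by ring.
  apply Rmult_le_compat; [apply Rmult_le_pos; nra | apply Rabs_pos | | ].
  - apply Rmult_le_compat_r; nra.
  - eapply Rle_trans; [apply trig_combination_bound|].
    apply sqrt_le_1_alt. unfold fourier_sq, fourier_cos, fourier_sin. nra.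
Qed.

Lemma sobolev_weight_succ (m : R) (n : nat) :
  Rpower (1 + INR n ^ 2) m
  = Rpower (1 + INR n ^ 2) (m - 1) * (1 + INR n ^ 2).
Proof.
  assert (H := pow2_ge_0 (INR n)).
  rewrite <- (Rpower_1 (1 + INR n ^ 2)) at 3 by lra.
  rewrite <- Rpower_plus. f_equal. ring.
Qed.

Lemma ex_series_sobolev_lower (m : R) (f : R -> R) :
  ex_series (sobolev_term m f) ->
  ex_series (fun n => Rpower (1 + INR n ^ 2) (m - 1) * (INR n ^ 2 * fourier_sq f n)).
Proof.
  apply ex_series_Rle. intros n. unfold sobolev_term.
  assert (H1 := pow2_ge_0 (INR n)). assert (Hq := fourier_sq_pos f n).
  rewrite (sobolev_weight_succ m).
  assert (H : 0 < Rpower (1 + INR n ^ 2) (m - 1)) by apply exp_pos.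
  split; [apply Rmult_le_pos; [lra | nra]|].
  rewrite Rmult_assoc. apply Rmult_le_compat_l; nra.
Qed.

(** The Fourier series and its termwise derivative both converge uniformly. The derived terms are of
    size n |f^(n)|, which is summable by the argument for f with exponent m - 1 > 1/2. *)
Lemma sobolev_C1 (m : R) (f : R -> R) :
  3 / 2 < m -> sobolev m f ->
  (forall x, ex_derive f x) /\ (forall x, continuous (Derive f) x).
Proof.
  intros Hm Hf. generalize Hf. intros [Hp [Hc Hs]].
  set (fn := fun n x => sum_f_R0 (fun k => mode f k x) n).
  set (dfn := fun n x => sum_f_R0 (fun k => mode_derive f k x) n).
  assert (Hd : forall n x, is_derive (fn n) x (dfn n x)).
  { intros n x. unfold fn, dfn. induction n as [|n IH]; simpl.
    - apply is_derive_mode.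
    - apply (is_derive_plus (fun y => sum_f_R0 (fun k => mode f k y) n) (mode f (S n)));
        [exact IH | apply is_derive_mode]. }
  assert (HD : forall n, Derive (fn n) = dfn n).
  { intros n. apply functional_extensionality. intros x.
    apply is_derive_unique, Hd. }
  assert (Hdc : forall n x, continuity_pt (dfn n) x).
  { intros n x. apply continuity_pt_filterlim.
    apply (continuous_sum_f_R0 (mode_derive f)). intros k. unfold mode_derive.
    solve_continuous. }
  assert (Hu : CVU_dom fn (fun _ => True)).
  { apply Mtest_CVU with (fun n => 2 * sqrt (fourier_sq f n)); [apply mode_bound|].
    apply ex_series_sqrt with m; [lra | apply fourier_sq_pos | exact Hs]. }
  assert (Hdu : CVU_dom dfn (fun _ => True)).
  { apply Mtest_CVU with (fun n => 2 * PI * (2 * sqrt (INR n ^ 2 * fourier_sq f n)));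
      [apply mode_derive_bound|].
    apply ex_series_Rscal. apply ex_series_sqrt with (m - 1); [lra | |].
    - intros n. apply Rmult_le_pos; [apply pow2_ge_0 | apply fourier_sq_pos].
    - now apply ex_series_sobolev_lower. }
  assert (Hlim : forall x, real (Lim_seq (fun n => fn n x)) = f x).
  { intros x. assert (H := sobolev_mode_series m f x ltac:(lra) Hf).
    apply is_series_Reals in H. apply is_lim_seq_Reals in H.
    exact (f_equal real (is_lim_seq_unique _ _ H)). }
  assert (Hconn : is_connected (fun _ : R => True)) by (intros a b x _ _ _; trivial).
  assert (Hder : forall x, is_derive f x (real (Lim_seq (fun n => dfn n x)))).
  { intros x. apply is_derive_ext with (1 := Hlim).
    rewrite <- (Lim_seq_ext (fun n => Derive (fn n) x)) by (intros n; now rewrite HD).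
    apply (CVU_Derive fn (fun _ => True)); trivial.
    - apply open_true.
    - intros n y _. eexists. apply Hd.
    - intros n y _. rewrite HD. apply Hdc.
    - now replace (fun n x => Derive (fn n) x) with dfn
        by (apply functional_extensionality; intros n; now rewrite HD). }
  split.
  - intros x. eexists. apply Hder.
  - intros x. replace (Derive f) with (fun x => real (Lim_seq (fun n => dfn n x)))
      by (apply functional_extensionality; intros y; symmetry;
          apply is_derive_unique, Hder).
    apply continuity_pt_filterlim.
    apply (CVU_cont_open dfn (fun _ => True)); auto. apply open_true.
Qed.

Lemma Derive_periodic (f : R -> R) :
  (forall x, f (x + 1) = f x) -> forall x, Derive f (x + 1) = Derive f x.
Proof.
  intros Hp x. unfold Derive. f_equal. apply Lim_ext. intros h.
  now replace (x + 1 + h) with (x + h + 1) by ring; rewrite !Hp.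
Qed.

Lemma RInt_derive_periodic (h dh : R -> R) :
  (forall x, is_derive h x (dh x)) -> (forall x, continuous dh x) ->
  h 1 = h 0 -> RInt dh 0 1 = 0.
Proof.
  intros Hd Hc Hp.
  rewrite (is_RInt_unique dh 0 1 (minus (h 1) (h 0))).
  - rewrite Hp. apply Rminus_diag.
  - apply (is_RInt_derive (V := R_CompleteNormedModule)); intros; [apply Hd | apply Hc].
Qed.

(** Integration by parts over a period: the derivatives of f cos (w x) and f sin (w x) have integral
    zero, so differentiation multiplies by w and exchanges the cosine and sine coefficients up to
    sign. *)
Lemma fourier_sq_derive (f : R -> R) (n : nat) :
  (forall x, f (x + 1) = f x) -> (forall x, ex_derive f x) ->
  (forall x, continuous (Derive f) x) ->
  fourier_sq (Derive f) n = (2 * PI * INR n) ^ 2 * fourier_sq f n.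
Proof.
  intros Hp Hd Hc.
  assert (Hf : forall x, continuous f x)
    by (intros x; apply (ex_derive_continuous (V := R_NormedModule)), Hd).
  assert (Hp1 : f 1 = f 0) by (rewrite <- (Hp 0); f_equal; ring).
  set (w := 2 * PI * INR n).
  assert (H1 : RInt (fun x => Derive f x * cos (w * x)
                 - w * (f x * sin (w * x))) 0 1 = 0).
  { apply (RInt_derive_periodic (fun x => f x * cos (w * x))).
    - intros x. auto_derive; [exact (Hd x)|]. change (Derive (fun y => f y) x) with (Derive f x).
      Req. ring.
    - solve_continuous.
    - rewrite Hp1. unfold w. rewrite <- (cos_periodic_nat n 0). do 3 f_equal. ring. }
  assert (H2 : RInt (fun x => Derive f x * sin (w * x)
                 + w * (f x * cos (w * x))) 0 1 = 0).
  { apply (RInt_derive_periodic (fun x => f x * sin (w * x))).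
    - intros x. auto_derive; [exact (Hd x)|]. change (Derive (fun y => f y) x) with (Derive f x).
      Req. ring.
    - solve_continuous.
    - rewrite Hp1. unfold w. rewrite <- (sin_periodic_nat n 0). do 3 f_equal. ring. }
  rewrite RInt_Rminus, RInt_Rscal in H1 by solve_continuous.
  rewrite RInt_Rplus, RInt_Rscal in H2 by solve_continuous.
  unfold fourier_sq. fold w.
  replace (RInt (fun x => Derive f x * cos (w * x)) 0 1)
    with (w * RInt (fun x => f x * sin (w * x)) 0 1) by lra.
  replace (RInt (fun x => Derive f x * sin (w * x)) 0 1)
    with (- (w * RInt (fun x => f x * cos (w * x)) 0 1)) by lra.
  ring.
Qed.

Lemma sobolev_derive (m : R) (f : R -> R) :
  3 / 2 < m -> sobolev m f ->
  sobolev (m - 1) (Derive f) /\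
  sobolev_norm (m - 1) (Derive f) <= 2 * PI * sobolev_norm m f.
Proof.
  intros Hm Hf. destruct (sobolev_C1 m f Hm Hf) as [Hd Hc].
  destruct Hf as [Hp [Hcf Hs]]. assert (HPI := PI_RGT_0).
  assert (Hb : forall n, 0 <= sobolev_term (m - 1) (Derive f) n
                         <= (2 * PI) ^ 2 * sobolev_term m f n).
  { intros n. unfold sobolev_term. rewrite fourier_sq_derive by assumption.
    assert (H1 := pow2_ge_0 (INR n)). assert (Hq := fourier_sq_pos f n).
    rewrite (sobolev_weight_succ m).
    assert (H : 0 < Rpower (1 + INR n ^ 2) (m - 1)) by apply exp_pos.
    split.
    - apply Rmult_le_pos; [lra|]. apply Rmult_le_pos; [apply pow2_ge_0 | lra].
    - replace ((2 * PI) ^ 2 * (Rpower (1 + INR n ^ 2) (m - 1) * (1 + INR n ^ 2)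
          * fourier_sq f n))
        with (Rpower (1 + INR n ^ 2) (m - 1)
          * (((2 * PI) ^ 2 * (1 + INR n ^ 2)) * fourier_sq f n)) by ring.
      apply Rmult_le_compat_l; [lra|]. apply Rmult_le_compat_r; [lra|]. nra. }
  assert (He : ex_series (fun n => (2 * PI) ^ 2 * sobolev_term m f n))
    by now apply ex_series_Rscal.
  split; [split; [|split]|].
  - now apply Derive_periodic.
  - exact Hc.
  - apply ex_series_Rle with (1 := Hb). exact He.
  - unfold sobolev_norm.
    rewrite <- (sqrt_pow2 (2 * PI)) at 1 by lra.
    rewrite <- sqrt_mult_alt by apply pow2_ge_0.
    apply sqrt_le_1_alt. rewrite <- Series_scal_l. apply Series_le; assumption.
Qed.

(** * The Riccati equation *)

Lemma continuous_bounded (V : R -> R) (a b : R) :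
  a <= b -> (forall t, a <= t <= b -> continuous V t) ->
  exists M, forall t, a <= t <= b -> Rabs (V t) <= M.
Proof.
  intros Hab HV.
  destruct (continuity_ab_maj (fun t => Rabs (V t)) a b Hab) as [y [Hy _]].
  - intros c Hc. apply continuity_pt_filterlim.
    apply (continuous_comp V Rabs); [now apply HV | apply continuous_Rabs].
  - now exists (Rabs (V y)).
Qed.

(** Stated for the eta-expanded function, the form in which [auto_derive] leaves derivatives of
    unknown functions. *)
Lemma Derive_eta (f : R -> R) (t l : R) :
  is_derive f t l -> Derive (fun x : R => f x) t = l.
Proof. apply is_derive_unique. Qed.

(** Gronwall: with |V| <= M, the function N^2 exp (- 2 M t) has derivative - 2 (V + M) N^2 exp (- 2
    M t) <= 0, so it cannot leave 0. The derivative is taken in the open interval because at t = 0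
    it is one-sided. *)
Lemma linear_ode_unique (N V : R -> R) (a b : R) :
  a <= b ->
  (forall t, a <= t <= b -> continuous N t) ->
  (forall t, a <= t <= b -> continuous V t) ->
  (forall t, a < t < b -> is_derive N t (- V t * N t)) ->
  N a = 0 -> N b = 0.
Proof.
  intros Hab HN HV HD Ha.
  destruct (continuous_bounded V a b Hab HV) as [M HM].
  destruct (MVT_gen (fun t => N t ^ 2 * exp (- (2 * M * t))) a b
    (fun t => - 2 * (V t + M) * (N t ^ 2 * exp (- (2 * M * t))))) as [c [Hc E]].
  - rewrite Rmin_left, Rmax_right by exact Hab. intros t Ht.
    assert (H := HD t Ht). auto_derive.
    + now exists (- V t * N t).
    + rewrite (Derive_eta N t _ H). Req. ring.
  - rewrite Rmin_left, Rmax_right by exact Hab. intros t Ht.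
    apply continuity_pt_filterlim.
    assert (HNt := HN t Ht).
    apply (continuous_Rmult (fun t => N t ^ 2) (fun t => exp (- (2 * M * t)))).
    + solve_continuous.
    + apply (ex_derive_continuous (V := R_NormedModule)). auto_derive. trivial.
  - rewrite Rmin_left, Rmax_right in Hc by exact Hab.
    rewrite Ha in E.
    assert (HMc := HM c Hc). apply Rabs_le_between in HMc.
    assert (He : forall y, 0 < exp y) by apply exp_pos.
    assert (H1 := He (- (2 * M * b))). assert (H2 := He (- (2 * M * c))).
    assert (H3 := pow2_ge_0 (N c)). assert (H4 := pow2_ge_0 (N b)).
    assert (H5 : 0 <= (V c + M) * (N c ^ 2 * exp (- (2 * M * c))) * (b - a)).
    { apply Rmult_le_pos; [|lra]. apply Rmult_le_pos; [lra|].
      apply Rmult_le_pos; lra. }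
    assert (H6 : N b ^ 2 * exp (- (2 * M * b)) <= 0) by nra.
    assert (H7 : N b ^ 2 <= 0) by nra. nra.
Qed.

(* With y = v + i z this is the complex Riccati equation y' = - (y^2 + om^2) / 2. *)
Definition riccati_on (om b : R) (v z : R -> R) : Prop :=
  (forall t, 0 <= t <= b -> continuous v t /\ continuous z t) /\
  (forall t, 0 < t < b ->
     is_derive v t (- (1 / 2) * v t ^ 2 + 1 / 2 * z t ^ 2 - om ^ 2 / 2) /\
     is_derive z t (- z t * v t)).

(** Fundamental solutions of w'' = - (om^2 / 4) w. Dividing by om gives [Sin] the slope 1/2 at 0, so
    that 2 w'(0) is exactly the coefficient of [Sin]. *)
Definition Cos (om t : R) : R := cos (om / 2 * t).
Definition Sin (om t : R) : R := sin (om / 2 * t) / om.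

Lemma Cos_Sin_unit (om t : R) :
  om <> 0 -> Cos om t ^ 2 + om ^ 2 * Sin om t ^ 2 = 1.
Proof.
  intros Hom. unfold Cos, Sin.
  rewrite <- (sin2_cos2 (om / 2 * t)). unfold Rsqr. field. exact Hom.
Qed.

Lemma is_derive_Cos (om t : R) :
  om <> 0 -> is_derive (Cos om) t (- (om ^ 2 / 2) * Sin om t).
Proof.
  intros Hom. unfold Cos, Sin. auto_derive; [trivial|]. Req. field. exact Hom.
Qed.

Lemma is_derive_Sin (om t : R) :
  om <> 0 -> is_derive (Sin om) t (Cos om t / 2).
Proof.
  intros Hom. unfold Cos, Sin. auto_derive; [trivial|]. Req. field. exact Hom.
Qed.

Lemma continuous_Cos (om t : R) : continuous (Cos om) t.
Proof.
  apply (ex_derive_continuous (V := R_NormedModule)). unfold Cos. auto_derive. trivial.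
Qed.

Lemma continuous_Sin (om t : R) : continuous (Sin om) t.
Proof.
  apply (ex_derive_continuous (V := R_NormedModule)). unfold Sin. auto_derive. trivial.
Qed.

(* The linear equation w'' = - (om^2 / 4) w with w(0) = 1 and w'(0) = (v0 + i z0) / 2,
   whose logarithmic derivative solves the Riccati equation: w = wre + i wim and
   2 w' = dwre + i dwim. *)
Definition wre (om v0 t : R) : R := Cos om t + v0 * Sin om t.
Definition wim (om z0 t : R) : R := z0 * Sin om t.
Definition dwre (om v0 t : R) : R := v0 * Cos om t - om ^ 2 * Sin om t.
Definition dwim (om z0 t : R) : R := z0 * Cos om t.

Lemma is_derive_wre (om v0 t : R) :
  om <> 0 -> is_derive (wre om v0) t (dwre om v0 t / 2).
Proof.
  intros Hom. unfold wre, dwre.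
  assert (HC := is_derive_Cos om t Hom). assert (HS := is_derive_Sin om t Hom).
  auto_derive.
  - split; [|split]; trivial; eexists; eassumption.
  - rewrite (Derive_eta (Cos om) t _ HC),
      (Derive_eta (Sin om) t _ HS). Req. field.
Qed.

Lemma is_derive_wim (om z0 t : R) :
  om <> 0 -> is_derive (wim om z0) t (dwim om z0 t / 2).
Proof.
  intros Hom. unfold wim, dwim. assert (HS := is_derive_Sin om t Hom).
  auto_derive.
  - eexists; eassumption.
  - rewrite (Derive_eta (Sin om) t _ HS). Req. field.
Qed.

Lemma is_derive_dwre (om v0 t : R) :
  om <> 0 -> is_derive (dwre om v0) t (- (om ^ 2 / 2) * wre om v0 t).
Proof.
  intros Hom. unfold wre, dwre.
  assert (HC := is_derive_Cos om t Hom). assert (HS := is_derive_Sin om t Hom).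
  auto_derive.
  - split; [|split]; trivial; eexists; eassumption.
  - rewrite (Derive_eta (Cos om) t _ HC),
      (Derive_eta (Sin om) t _ HS). Req. field.
Qed.

Lemma is_derive_dwim (om z0 t : R) :
  om <> 0 -> is_derive (dwim om z0) t (- (om ^ 2 / 2) * wim om z0 t).
Proof.
  intros Hom. unfold wim, dwim. assert (HC := is_derive_Cos om t Hom).
  auto_derive.
  - eexists; eassumption.
  - rewrite (Derive_eta (Cos om) t _ HC). Req. field.
Qed.

Lemma continuous_wre (om v0 t : R) : continuous (wre om v0) t.
Proof.
  assert (HC := continuous_Cos om). assert (HS := continuous_Sin om).
  unfold wre. solve_continuous.
Qed.

Lemma continuous_wim (om z0 t : R) : continuous (wim om z0) t.
Proof. assert (HS := continuous_Sin om). unfold wim. solve_continuous. Qed.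

Lemma continuous_dwre (om v0 t : R) : continuous (dwre om v0) t.
Proof.
  assert (HC := continuous_Cos om). assert (HS := continuous_Sin om).
  unfold dwre. solve_continuous.
Qed.

Lemma continuous_dwim (om z0 t : R) : continuous (dwim om z0) t.
Proof. assert (HC := continuous_Cos om). unfold dwim. solve_continuous. Qed.

(* The defect q = (v + i z) w - 2 w' satisfies q' = - (v + i z) q / 2 and q(0) = 0, so
   |q|^2 solves a scalar linear equation. *)
Lemma riccati_linearization (om b : R) (v z : R -> R) :
  om <> 0 -> 0 <= b -> riccati_on om b v z ->
  v b * wre om (v 0) b - z b * wim om (z 0) b = dwre om (v 0) b /\
  v b * wim om (z 0) b + z b * wre om (v 0) b = dwim om (z 0) b.
Proof.
  intros Hom Hb [Hc Hd].
  set (A := wre om (v 0)). set (B := wim om (z 0)).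
  set (A2 := dwre om (v 0)). set (B2 := dwim om (z 0)).
  set (N := fun t => (v t * A t - z t * B t - A2 t) ^ 2
                     + (v t * B t + z t * A t - B2 t) ^ 2).
  enough (HN : N b = 0).
  { unfold N in HN.
    assert (H1 := pow2_ge_0 (v b * A b - z b * B b - A2 b)).
    assert (H2 := pow2_ge_0 (v b * B b + z b * A b - B2 b)).
    split; nra. }
  apply (linear_ode_unique N v 0 b Hb).
  - intros t Ht. destruct (Hc t Ht) as [Hv Hz].
    assert (HA : continuous A t) by apply continuous_wre.
    assert (HB : continuous B t) by apply continuous_wim.
    assert (HA2 : continuous A2 t) by apply continuous_dwre.
    assert (HB2 : continuous B2 t) by apply continuous_dwim.
    unfold N. clearbody A B A2 B2. solve_continuous.
  - intros t Ht. now apply Hc.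
  - intros t Ht. destruct (Hd t Ht) as [Hv Hz].
    assert (HA : is_derive A t (A2 t / 2)) by now apply is_derive_wre.
    assert (HB : is_derive B t (B2 t / 2)) by now apply is_derive_wim.
    assert (HA2 : is_derive A2 t (- (om ^ 2 / 2) * A t)) by now apply is_derive_dwre.
    assert (HB2 : is_derive B2 t (- (om ^ 2 / 2) * B t)) by now apply is_derive_dwim.
    unfold N. clearbody A B A2 B2. auto_derive.
    + repeat split; eexists; eassumption.
    + rewrite (Derive_eta v t _ Hv),
        (Derive_eta z t _ Hz),
        (Derive_eta A t _ HA),
        (Derive_eta B t _ HB),
        (Derive_eta A2 t _ HA2),
        (Derive_eta B2 t _ HB2). Req. field.
  - unfold N, A, B, A2, B2, wre, wim, dwre, dwim, Cos, Sin.
    rewrite Rmult_0_r, cos_0, sin_0. field. exact Hom.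
Qed.

(** The Wronskian-type combination Cos wre - Sin dwre equals Cos^2 + om^2 Sin^2 = 1 whatever v0 is.
    Real parts alone already exclude a common zero. *)
Lemma w_dw_independent (om v0 t : R) :
  om <> 0 ->
  ~ (wre om v0 t = 0 /\ dwre om v0 t = 0).
Proof.
  intros Hom [HA HA2]. assert (H := Cos_Sin_unit om t Hom).
  assert (E : Cos om t * wre om v0 t - Sin om t * dwre om v0 t = 1)
    by (unfold wre, dwre; rewrite <- H; ring).
  rewrite HA, HA2 in E. lra.
Qed.

Definition wsq (om v0 z0 t : R) : R := wre om v0 t ^ 2 + wim om z0 t ^ 2.

(** The left side is Im (2 w' conj w), constant in time; it turns z = Im (2 w' / w) into z0 /
    |w|^2. *)
Lemma w_wronskian (om v0 z0 t : R) :
  om <> 0 ->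
  dwim om z0 t * wre om v0 t - dwre om v0 t * wim om z0 t = z0.
Proof.
  intros Hom. transitivity (z0 * (Cos om t ^ 2 + om ^ 2 * Sin om t ^ 2)).
  - unfold wre, wim, dwre, dwim. ring.
  - rewrite Cos_Sin_unit by exact Hom. ring.
Qed.

(** If w(b) were 0, the relation y w = 2 w' with y(b) finite would force w'(b) = 0 too, against
    [w_dw_independent]. Then y = 2 w' conj w / |w|^2. *)
Lemma riccati_explicit (om b : R) (v z : R -> R) :
  om <> 0 -> 0 <= b -> riccati_on om b v z ->
  wsq om (v 0) (z 0) b <> 0 /\
  v b = (dwre om (v 0) b * wre om (v 0) b + dwim om (z 0) b * wim om (z 0) b)
        / wsq om (v 0) (z 0) b /\
  z b = z 0 / wsq om (v 0) (z 0) b.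
Proof.
  intros Hom Hb Hr.
  destruct (riccati_linearization om b v z Hom Hb Hr) as [E1 E2].
  assert (HD : wsq om (v 0) (z 0) b <> 0).
  { intros HD. unfold wsq in HD.
    assert (HA : wre om (v 0) b = 0) by nra.
    assert (HB : wim om (z 0) b = 0) by nra.
    apply (w_dw_independent om (v 0) b Hom). split; [exact HA|].
    rewrite <- E1, HA, HB. ring. }
  split; [exact HD|].
  assert (Hw := w_wronskian om (v 0) (z 0) b Hom).
  split.
  - rewrite <- E1, <- E2. unfold wsq in *. field. exact HD.
  - apply Rmult_eq_reg_r with (wsq om (v 0) (z 0) b); [|exact HD].
    unfold Rdiv. rewrite Rmult_assoc, Rinv_l, Rmult_1_r by exact HD.
    etransitivity; [|exact Hw]. rewrite <- E1, <- E2. unfold wsq. ring.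
Qed.

(** Both |y|^2 + om^2 and z solve the same linear equation N' = - v N, so their quotient is
    conserved. The cross-multiplied form also makes sense where z vanishes. *)
Lemma riccati_invariant (om b : R) (v z : R -> R) :
  0 <= b -> riccati_on om b v z ->
  (v b ^ 2 + z b ^ 2 + om ^ 2) * z 0 = z b * (v 0 ^ 2 + z 0 ^ 2 + om ^ 2).
Proof.
  intros Hb [Hc Hd].
  set (z0 := z 0). set (E0 := v 0 ^ 2 + z0 ^ 2 + om ^ 2).
  set (N := fun t => (v t ^ 2 + z t ^ 2 + om ^ 2) * z0 - z t * E0).
  enough (HN : N b = 0) by (unfold N in HN; lra).
  apply (linear_ode_unique N v 0 b Hb).
  - intros t Ht. destruct (Hc t Ht) as [Hv Hz]. unfold N. clearbody z0 E0.
    solve_continuous.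
  - intros t Ht. now apply Hc.
  - intros t Ht. destruct (Hd t Ht) as [Hv Hz].
    unfold N. clearbody z0 E0. auto_derive.
    + repeat split; eexists; eassumption.
    + rewrite (Derive_eta v t _ Hv),
        (Derive_eta z t _ Hz). Req. field.
  - unfold N, E0, z0. ring.
Qed.

(** For om = 0 the function |y|^2 itself solves N' = - v N. This settles the case in which the
    explicit solution would divide by zero. *)
Lemma riccati_stationary (b : R) (v z : R -> R) :
  0 <= b -> riccati_on 0 b v z -> v 0 = 0 -> z 0 = 0 -> v b = 0 /\ z b = 0.
Proof.
  intros Hb [Hc Hd] Hv0 Hz0.
  set (N := fun t => v t ^ 2 + z t ^ 2).
  enough (HN : N b = 0).
  { unfold N in HN. assert (H1 := pow2_ge_0 (v b)). assert (H2 := pow2_ge_0 (z b)).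
    split; nra. }
  apply (linear_ode_unique N v 0 b Hb).
  - intros t Ht. destruct (Hc t Ht) as [Hv Hz]. unfold N. solve_continuous.
  - intros t Ht. now apply Hc.
  - intros t Ht. destruct (Hd t Ht) as [Hv Hz].
    unfold N. auto_derive.
    + repeat split; eexists; eassumption.
    + rewrite (Derive_eta v t _ Hv),
        (Derive_eta z t _ Hz). Req. field.
  - unfold N. rewrite Hv0, Hz0. ring.
Qed.

(** * Families of periodic functions depending on time *)

Lemma lifespan_le (T : Rbar) (t tau : R) :
  lifespan T t -> 0 <= tau <= t -> lifespan T tau.
Proof.
  intros [Ht HT] H. split; [lra|].
  apply Rbar_le_lt_trans with t; [simpl; lra | exact HT].
Qed.

Lemma lifespan_interior (T : Rbar) (t : R) :
  0 < t -> lifespan T t ->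
  exists e, 0 < e /\ forall tau, Rabs (tau - t) < e -> 0 < tau /\ lifespan T tau.
Proof.
  intros Ht [_ HT].
  assert (H : exists d, 0 < d /\ Rbar_lt (t + d) T).
  { destruct T as [T| |]; simpl in *; [|exists 1; split; [lra|trivial]|contradiction].
    exists ((T - t) / 2). lra. }
  destruct H as [d [Hd HdT]].
  exists (Rmin t d). split; [now apply Rmin_glb_lt|].
  intros tau Htau. apply Rabs_lt_between in Htau.
  assert (H1 := Rmin_l t d). assert (H2 := Rmin_r t d).
  split; [lra|]. apply lifespan_le with (t + d); [split; [lra | exact HdT] | lra].
Qed.

Definition continuous_on (T : Rbar) (g : R -> R) : Prop :=
  forall t, lifespan T t -> forall eps, 0 < eps -> exists eta, 0 < eta /\
    forall tau, lifespan T tau -> Rabs (tau - t) < eta -> Rabs (g tau - g t) < eps.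

Lemma is_derive_on_eps (T : Rbar) (f : R -> R) (t l : R) :
  is_derive_on T f t l <->
  forall eps, 0 < eps -> exists eta, 0 < eta /\
    forall tau, lifespan T tau -> tau <> t -> Rabs (tau - t) < eta ->
      Rabs ((f tau - f t) / (tau - t) - l) < eps.
Proof.
  unfold is_derive_on. rewrite filterlim_locally. split.
  - intros H eps Heps. destruct (H (mkposreal eps Heps)) as [eta Heta].
    exists eta. split; [apply cond_pos|].
    intros tau Htau Hne Hd. exact (Heta tau Hd Hne Htau).
  - intros H eps. destruct (H eps (cond_pos eps)) as [eta [Heta Hl]].
    exists (mkposreal eta Heta). intros tau Hd Hne Htau. exact (Hl tau Htau Hne Hd).
Qed.

Lemma is_derive_is_derive_on (T : Rbar) (f : R -> R) (t l : R) :
  is_derive f t l -> is_derive_on T f t l.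
Proof.
  intros H. apply is_derive_on_eps. intros eps Heps.
  apply is_derive_Reals in H. destruct (H eps Heps) as [eta Heta].
  exists eta. split; [apply cond_pos|]. intros tau _ Hne Hd.
  specialize (Heta (tau - t)). replace (t + (tau - t)) with tau in Heta by ring.
  apply Heta; [lra | exact Hd].
Qed.

Lemma is_derive_on_interior (T : Rbar) (f : R -> R) (t l : R) :
  0 < t -> lifespan T t -> is_derive_on T f t l -> is_derive f t l.
Proof.
  intros Ht HT H. apply is_derive_Reals. intros eps Heps.
  destruct (proj1 (is_derive_on_eps T f t l) H eps Heps) as [eta [Heta Hl]].
  destruct (lifespan_interior T t Ht HT) as [e [He Hin]].
  exists (mkposreal (Rmin eta e) (Rmin_glb_lt _ _ _ Heta He)). intros h Hh0 Hh.
  simpl in Hh. assert (H1 := Rmin_l eta e). assert (H2 := Rmin_r eta e).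
  specialize (Hl (t + h)). replace (t + h - t) with h in Hl by ring.
  apply Hl; [|lra|lra].
  apply Hin. replace (t + h - t) with h by ring. lra.
Qed.

Lemma is_derive_on_continuous (T : Rbar) (f df : R -> R) :
  (forall t, lifespan T t -> is_derive_on T f t (df t)) -> continuous_on T f.
Proof.
  intros H t Ht eps Heps.
  destruct (proj1 (is_derive_on_eps T f t (df t)) (H t Ht) 1 Rlt_0_1)
    as [eta [Heta Hl]].
  set (K := Rabs (df t) + 1).
  assert (HK : 0 < K) by (unfold K; generalize (Rabs_pos (df t)); lra).
  exists (Rmin eta (eps / K)).
  assert (HeK : 0 < eps / K) by now apply Rdiv_lt_0_compat.
  split; [now apply Rmin_glb_lt|].
  intros tau Htau Hd. assert (H1 := Rmin_l eta (eps / K)).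
  assert (H2 := Rmin_r eta (eps / K)).
  destruct (Req_dec tau t) as [->|Hne].
  - rewrite Rminus_diag, Rabs_R0. exact Heps.
  - specialize (Hl tau Htau Hne ltac:(lra)).
    set (q := (f tau - f t) / (tau - t)) in *.
    assert (Hq : Rabs q <= K).
    { replace q with ((q - df t) + df t) by ring.
      eapply Rle_trans; [apply Rabs_triang|]. unfold K. lra. }
    replace (f tau - f t) with (q * (tau - t)) by (unfold q; field; lra).
    rewrite Rabs_mult.
    apply Rle_lt_trans with (K * Rabs (tau - t)).
    + apply Rmult_le_compat_r; [apply Rabs_pos | exact Hq].
    + apply Rlt_le_trans with (K * (eps / K)); [|right; field; lra].
      apply Rmult_lt_compat_l; lra.
Qed.

(** Freezing g at negative times turns one-sided continuity at 0 into two-sided continuity, as the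
    mean value theorem and [riccati_on] require. *)
Lemma continuous_on_clamp (T : Rbar) (g : R -> R) (t : R) :
  continuous_on T g -> lifespan T t -> continuous (fun tau => g (Rmax 0 tau)) t.
Proof.
  intros Hg Ht. apply continuous_eps. intros eps Heps.
  generalize Ht. intros [Ht0 HT].
  destruct (Hg t Ht eps Heps) as [eta [Heta Hl]].
  assert (H : exists e, 0 < e /\ forall tau, Rabs (tau - t) < e -> Rbar_lt (Rmax 0 tau) T).
  { destruct T as [T| |]; simpl in *; [|exists 1; split; [lra|trivial]|contradiction].
    exists (T - t). split; [lra|]. intros tau Htau. apply Rabs_lt_between in Htau.
    apply Rmax_lub_lt; lra. }
  destruct H as [e [He HeT]].
  exists (Rmin eta e). split; [now apply Rmin_glb_lt|]. intros tau Htau.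
  assert (H1 := Rmin_l eta e). assert (H2 := Rmin_r eta e).
  rewrite (Rmax_right 0 t) by exact Ht0.
  apply Hl.
  - split; [apply Rmax_l | apply HeT; lra].
  - eapply Rle_lt_trans; [|apply Rlt_le_trans with (1 := Htau); exact H1].
    unfold Rmax. destruct (Rle_dec 0 tau); [lra|].
    rewrite !Rabs_left1; lra.
Qed.

Lemma is_derive_clamp (g : R -> R) (t l : R) :
  0 < t -> is_derive g t l -> is_derive (fun tau => g (Rmax 0 tau)) t l.
Proof.
  intros Ht. apply is_derive_ext_loc. exists (mkposreal t Ht). intros y Hy.
  apply Rabs_lt_between in Hy. unfold minus, plus, opp in Hy; simpl in Hy.
  rewrite Rmax_right by lra. reflexivity.
Qed.

Lemma constant_on (T : Rbar) (g : R -> R) :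
  continuous_on T g ->
  (forall t, 0 < t -> lifespan T t -> is_derive g t 0) ->
  forall t, lifespan T t -> g t = g 0.
Proof.
  intros Hc Hd t Ht.
  destruct (MVT_gen (fun tau => g (Rmax 0 tau)) 0 t (fun _ => 0)) as [c [_ E]];
    try rewrite Rmin_left, Rmax_right by apply Ht.
  - intros x Hx. apply is_derive_clamp; [lra|].
    apply Hd; [lra|]. apply lifespan_le with t; [exact Ht | lra].
  - intros x Hx. apply continuity_pt_filterlim.
    apply (continuous_on_clamp T g x Hc). apply lifespan_le with t; [exact Ht | lra].
  - rewrite (Rmax_right 0 t), Rmax_left in E by (apply Ht || lra). lra.
Qed.

(** Continuous maps from [0,T) to the periodic continuous functions with the sup norm: all that the
    later arguments keep of the Sobolev regularity in time. *)
Definition continuous_family (T : Rbar) (f : R -> R -> R) : Prop :=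
  (forall t, lifespan T t ->
     (forall x, f t (x + 1) = f t x) /\ (forall x, continuous (f t) x)) /\
  (forall t, lifespan T t -> forall eps, 0 < eps -> exists eta, 0 < eta /\
     forall tau, lifespan T tau -> Rabs (tau - t) < eta ->
       forall x, Rabs (f tau x - f t x) < eps).

Lemma family_joint (T : Rbar) (f : R -> R -> R) (t x eps : R) :
  continuous_family T f -> lifespan T t -> 0 < eps ->
  exists eta, 0 < eta /\ forall tau y, lifespan T tau -> Rabs (tau - t) < eta ->
    Rabs (y - x) < eta -> Rabs (f tau y - f t x) < eps.
Proof.
  intros [Hs Hu] Ht Heps.
  destruct (Hu t Ht (eps / 2) ltac:(lra)) as [e1 [He1 H1]].
  destruct (proj1 (continuous_eps (f t) x) (proj2 (Hs t Ht) x) (eps / 2) ltac:(lra))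
    as [e2 [He2 H2]].
  exists (Rmin e1 e2). split; [now apply Rmin_glb_lt|].
  intros tau y Htau Hd Hy.
  assert (H3 := Rmin_l e1 e2). assert (H4 := Rmin_r e1 e2).
  specialize (H1 tau Htau ltac:(lra) y). specialize (H2 y ltac:(lra)).
  replace (f tau y - f t x) with ((f tau y - f t y) + (f t y - f t x)) by ring.
  eapply Rle_lt_trans; [apply Rabs_triang | lra].
Qed.

Lemma family_plus (T : Rbar) (f g : R -> R -> R) :
  continuous_family T f -> continuous_family T g ->
  continuous_family T (fun t x => f t x + g t x).
Proof.
  intros [Hf Uf] [Hg Ug]. split.
  - intros t Ht. destruct (Hf t Ht) as [Pf Cf]. destruct (Hg t Ht) as [Pg Cg].
    split; intros x; [now rewrite Pf, Pg | apply continuous_Rplus; auto].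
  - intros t Ht eps Heps.
    destruct (Uf t Ht (eps / 2) ltac:(lra)) as [e1 [He1 H1]].
    destruct (Ug t Ht (eps / 2) ltac:(lra)) as [e2 [He2 H2]].
    exists (Rmin e1 e2). split; [now apply Rmin_glb_lt|].
    intros tau Htau Hd x.
    assert (H3 := Rmin_l e1 e2). assert (H4 := Rmin_r e1 e2).
    specialize (H1 tau Htau ltac:(lra) x). specialize (H2 tau Htau ltac:(lra) x).
    replace (f tau x + g tau x - (f t x + g t x))
      with ((f tau x - f t x) + (g tau x - g t x)) by ring.
    eapply Rle_lt_trans; [apply Rabs_triang | lra].
Qed.

Lemma family_mult (T : Rbar) (f g : R -> R -> R) :
  continuous_family T f -> continuous_family T g ->
  continuous_family T (fun t x => f t x * g t x).
Proof.
  intros [Hf Uf] [Hg Ug]. split.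
  - intros t Ht. destruct (Hf t Ht) as [Pf Cf]. destruct (Hg t Ht) as [Pg Cg].
    split; intros x; [now rewrite Pf, Pg | apply continuous_Rmult; auto].
  - intros t Ht eps Heps. destruct (Hf t Ht) as [Pf Cf]. destruct (Hg t Ht) as [Pg Cg].
    destruct (periodic_bounded (f t) Pf Cf) as [M [HM HfM]].
    destruct (periodic_bounded (g t) Pg Cg) as [L [HL HgL]].
    (* For increments a, b below e <= 1, the quadratic term |a| |b| is below e, and the product
       changes by less than e (1 + M + L) <= eps. *)
    set (e := Rmin 1 (eps / (1 + M + L))).
    assert (Hq : 0 < eps / (1 + M + L)) by (apply Rdiv_lt_0_compat; lra).
    assert (He : 0 < e) by (unfold e; apply Rmin_glb_lt; lra).
    assert (He1 : e <= 1) by apply Rmin_l.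
    assert (He2 : e * (1 + M + L) <= eps).
    { apply Rle_trans with (eps / (1 + M + L) * (1 + M + L)); [|right; field; lra].
      apply Rmult_le_compat_r; [lra | apply Rmin_r]. }
    destruct (Uf t Ht e He) as [e1 [He1' H1]].
    destruct (Ug t Ht e He) as [e2 [He2' H2]].
    exists (Rmin e1 e2). split; [now apply Rmin_glb_lt|].
    intros tau Htau Hd x.
    assert (H3 := Rmin_l e1 e2). assert (H4 := Rmin_r e1 e2).
    specialize (H1 tau Htau ltac:(lra) x). specialize (H2 tau Htau ltac:(lra) x).
    specialize (HfM x). specialize (HgL x).
    apply Rabs_lt_between in H1, H2. apply Rabs_le_between in HfM, HgL.
    replace (f tau x * g tau x - f t x * g t x)
      with ((f tau x - f t x) * (g tau x - g t x)
            + f t x * (g tau x - g t x) + (f tau x - f t x) * g t x) by ring.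
    set (a := f tau x - f t x) in *. set (b := g tau x - g t x) in *.
    assert (Ha : Rabs a < e) by (apply Rabs_lt_between; lra).
    assert (Hb : Rabs b < e) by (apply Rabs_lt_between; lra).
    assert (HA : Rabs (f t x) <= M) by (apply Rabs_le_between; lra).
    assert (HB : Rabs (g t x) <= L) by (apply Rabs_le_between; lra).
    eapply Rle_lt_trans; [apply Rabs_triang|].
    eapply Rle_lt_trans; [apply Rplus_le_compat_r, Rabs_triang|].
    rewrite !Rabs_mult.
    assert (P1 := Rabs_pos a). assert (P2 := Rabs_pos b).
    assert (P3 := Rabs_pos (f t x)). assert (P4 := Rabs_pos (g t x)).
    assert (Q1 : Rabs a * Rabs b < e).
    { apply Rle_lt_trans with (1 * Rabs b); [apply Rmult_le_compat_r; lra | lra]. }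
    assert (Q2 : Rabs (f t x) * Rabs b <= M * e) by (apply Rmult_le_compat; lra).
    assert (Q3 : Rabs a * Rabs (g t x) <= e * L) by (apply Rmult_le_compat; lra).
    lra.
Qed.

Lemma family_const (T : Rbar) (g : R -> R) :
  continuous_on T g -> continuous_family T (fun t _ => g t).
Proof.
  intros Hg. split.
  - intros t _. split; intros x; [reflexivity | apply continuous_const].
  - intros t Ht eps Heps. destruct (Hg t Ht eps Heps) as [eta [Heta H]].
    exists eta. split; [exact Heta|]. intros tau Htau Hd _. now apply H.
Qed.

Lemma continuous_on_cst (T : Rbar) (c : R) : continuous_on T (fun _ => c).
Proof.
  intros t _ eps Heps. exists 1. split; [lra|]. intros.
  rewrite Rminus_diag, Rabs_R0. exact Heps.
Qed.

Lemma family_cst (T : Rbar) (c : R) : continuous_family T (fun _ _ => c).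
Proof. apply (family_const T (fun _ => c)), continuous_on_cst. Qed.

Lemma family_RInt (T : Rbar) (f : R -> R -> R) :
  continuous_family T f -> continuous_on T (fun t => RInt (f t) 0 1).
Proof.
  intros [Hf Uf] t Ht eps Heps.
  destruct (Uf t Ht (eps / 2) ltac:(lra)) as [eta [Heta H]].
  exists eta. split; [exact Heta|]. intros tau Htau Hd.
  destruct (Hf t Ht) as [_ C1]. destruct (Hf tau Htau) as [_ C2].
  rewrite <- RInt_Rminus by assumption.
  apply Rle_lt_trans with ((1 - 0) * (eps / 2)); [|lra].
  apply abs_RInt_le_const; [lra | solve_ex_RInt|].
  intros x _. apply Rlt_le. now apply H.
Qed.

(** Conservation law G_t = F = H_x with periodic flux H: differentiate under the integral for t > 0
    and use continuity to reach t = 0. *)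
Lemma conserved_integral (T : Rbar) (G F H : R -> R -> R) :
  continuous_family T G -> continuous_family T F ->
  (forall t x, 0 < t -> lifespan T t ->
     is_derive (fun tau : R => G tau x) t (F t x)) ->
  (forall t x, lifespan T t -> is_derive (H t) x (F t x)) ->
  (forall t, lifespan T t -> H t 1 = H t 0) ->
  forall t, lifespan T t -> RInt (G t) 0 1 = RInt (G 0) 0 1.
Proof.
  intros HG HF Hd HH Hp t Ht.
  apply (constant_on T (fun t => RInt (G t) 0 1)); [now apply family_RInt | | exact Ht].
  clear t Ht. intros t Ht0 Ht.
  destruct (lifespan_interior T t Ht0 Ht) as [e [He Hin]].
  assert (HD : forall tau x, Rabs (tau - t) < e ->
    is_derive (fun z : R => G z x) tau (F tau x)).
  { intros tau x Htau. now apply Hd; apply Hin. }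
  assert (HDt : forall x, is_derive (fun z : R => G z x) t (F t x)).
  { intros x. apply HD. now rewrite Rminus_diag, Rabs_R0. }
  assert (E : RInt (fun x => Derive (fun u => G u x) t) 0 1 = 0).
  { rewrite (RInt_ext _ (F t)) by (intros x _; apply is_derive_unique, HDt).
    apply (RInt_derive_periodic (H t)); auto. now apply (proj1 HF). }
  apply (eq_rect _ (fun l => is_derive (fun tau => RInt (G tau) 0 1) t l))
    with (2 := E).
  apply is_derive_RInt_param.
  - exists (mkposreal e He). intros tau Htau x _. eexists. now apply HD.
  - intros x _ eps.
    destruct (family_joint T F t x eps HF Ht (cond_pos eps)) as [eta [Heta Hj]].
    exists (mkposreal (Rmin eta e) (Rmin_glb_lt _ _ _ Heta He)).
    simpl. intros tau y Htau Hy.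
    assert (H1 := Rmin_l eta e). assert (H2 := Rmin_r eta e).
    rewrite (is_derive_unique _ _ _ (HD tau y ltac:(lra))),
      (is_derive_unique _ _ _ (HDt x)).
    apply Hj; [apply Hin | |]; lra.
  - exists (mkposreal e He). intros tau Htau. destruct (Hin tau Htau) as [_ H2].
    destruct (proj1 HG tau H2) as [_ C]. solve_ex_RInt.
Qed.

Lemma C_sobolev_family (T : Rbar) (m : R) (f : R -> R -> R) :
  1 / 2 < m -> C_sobolev T m f -> continuous_family T f.
Proof.
  intros Hm Hf. split.
  - intros t Ht. destruct (Hf t Ht) as [[Hp [Hc _]] _]. now split.
  - intros t Ht eps Heps. destruct (Hf t Ht) as [Hs Hl].
    set (K := Series (fun n => Rpower (1 + INR n ^ 2) (- m))).
    (* [lam] is fixed first, making the constant term K / lam at most eps / 2; the norm is then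
       taken so small that its term is at most eps / 4. *)
    set (lam := (2 * Rabs K + 1) / eps).
    assert (HK := Rabs_pos K).
    assert (Hlam : 0 < lam) by (apply Rdiv_lt_0_compat; lra).
    assert (HK2 : / lam * K <= eps / 2).
    { unfold lam. replace (/ ((2 * Rabs K + 1) / eps) * K)
        with (eps * K / (2 * Rabs K + 1)) by (field; lra).
      apply Rmult_le_reg_r with (2 * Rabs K + 1); [lra|].
      unfold Rdiv. rewrite Rmult_assoc, Rinv_l, Rmult_1_r by lra.
      generalize (Rle_abs K). nra. }
    (* The bound d <= 1 turns a norm below d into a squared norm at most d. *)
    set (d := Rmin 1 (eps / (4 * lam))).
    assert (Hd0 : 0 < eps / (4 * lam)) by (apply Rdiv_lt_0_compat; lra).
    assert (Hd : 0 < d) by (unfold d; apply Rmin_glb_lt; lra).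
    assert (Hd1 : d <= 1) by apply Rmin_l.
    assert (Hd2 : lam * d <= eps / 4).
    { apply Rle_trans with (lam * (eps / (4 * lam))); [|right; field; lra].
      apply Rmult_le_compat_l; [lra | apply Rmin_r]. }
    apply filterlim_locally with (eps := mkposreal d Hd) in Hl.
    destruct Hl as [eta Heta]. exists eta. split; [apply cond_pos|].
    intros tau Htau Htd x. specialize (Heta tau Htd Htau).
    change (Rabs (sobolev_norm m (fun x => f tau x - f t x) - 0) < d) in Heta.
    rewrite Rminus_0_r in Heta. apply Rabs_lt_between in Heta.
    assert (Hn : 0 <= sobolev_norm m (fun x => f tau x - f t x)) by apply sqrt_pos.
    assert (Hb := sobolev_sup_bound m lam (fun x => f tau x - f t x) x Hm
      (sobolev_minus m _ _ (proj1 (Hf tau Htau)) Hs) Hlam).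
    fold K in Hb. set (nn := sobolev_norm m (fun x => f tau x - f t x)) in *.
    assert (nn ^ 2 <= d) by nra. simpl in Hb.
    assert (lam * nn ^ 2 <= lam * d) by (apply Rmult_le_compat_l; lra).
    simpl in *. lra.
Qed.

Lemma C_sobolev_derive (T : Rbar) (m : R) (f : R -> R -> R) :
  3 / 2 < m -> C_sobolev T m f -> C_sobolev T (m - 1) (fun t => Derive (f t)).
Proof.
  intros Hm Hf t Ht. destruct (Hf t Ht) as [Hs Hl].
  split; [now apply sobolev_derive|]. assert (HPI := PI_RGT_0).
  apply filterlim_locally. intros eps.
  assert (He : 0 < eps / (2 * PI)) by (apply Rdiv_lt_0_compat; [apply cond_pos | lra]).
  apply filterlim_locally with (eps := mkposreal _ He) in Hl.
  destruct Hl as [eta Heta]. exists eta. intros tau Htd Htau.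
  specialize (Heta tau Htd Htau).
  change (Rabs (sobolev_norm m (fun x => f tau x - f t x) - 0) < eps / (2 * PI)) in Heta.
  change (Rabs (sobolev_norm (m - 1) (fun x => Derive (f tau) x - Derive (f t) x) - 0) < eps).
  replace (fun x => Derive (f tau) x - Derive (f t) x)
    with (Derive (fun x => f tau x - f t x)).
  - rewrite Rminus_0_r in *. rewrite Rabs_pos_eq in * by apply sqrt_pos.
    eapply Rle_lt_trans.
    + apply (sobolev_derive m _ Hm). apply sobolev_minus; [apply (Hf tau Htau) | exact Hs].
    + apply Rlt_le_trans with (2 * PI * (eps / (2 * PI))); [|right; field; lra].
      apply Rmult_lt_compat_l; lra.
  - apply functional_extensionality. intros x. apply Derive_minus;
      apply (sobolev_C1 m); auto. apply (Hf tau Htau).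
Qed.

(** Chain rule with a time derivative known only at the fixed point [phi t]. The increment is split
    at f tau (phi t); the spatial part is handled by the mean value theorem at time tau and the
    joint continuity of f_x. *)
Lemma is_derive_on_along (T : Rbar) (f : R -> R -> R) (phi : R -> R) (t ft dphi : R) :
  lifespan T t ->
  (forall tau x, lifespan T tau -> ex_derive (f tau) x) ->
  continuous_family T (fun tau => Derive (f tau)) ->
  is_derive_on T (fun tau => f tau (phi t)) t ft ->
  is_derive_on T phi t dphi ->
  continuous_on T phi ->
  is_derive_on T (fun tau => f tau (phi tau)) t (ft + Derive (f t) (phi t) * dphi).
Proof.
  intros Ht Hex Hfx Hft Hphi Hc.
  (* Where phi returns to phi t, the value of the quotient is set to its expected limit; it is
     multiplied by a zero increment there. *)
  set (k := fun tau => match Req_EM_T (phi tau) (phi t) with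
    | left _ => Derive (f t) (phi t)
    | right _ => (f tau (phi tau) - f tau (phi t)) / (phi tau - phi t) end).
  assert (Hk : filterlim k (within (lifespan T) (locally' t))
                 (locally (Derive (f t) (phi t)))).
  { apply filterlim_locally. intros eps.
    destruct (family_joint T _ t (phi t) eps Hfx Ht (cond_pos eps)) as [e1 [He1 H1]].
    destruct (Hc t Ht e1 He1) as [e2 [He2 H2]].
    exists (mkposreal (Rmin e1 e2) (Rmin_glb_lt _ _ _ He1 He2)).
    intros tau Hd _ Htau. change (Rabs (tau - t) < Rmin e1 e2) in Hd.
    change (Rabs (k tau - Derive (f t) (phi t)) < eps).
    assert (H3 := Rmin_l e1 e2). assert (H4 := Rmin_r e1 e2).
    specialize (H2 tau Htau ltac:(lra)).
    unfold k. destruct (Req_EM_T (phi tau) (phi t)) as [E|E].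
    - rewrite Rminus_diag, Rabs_R0. apply cond_pos.
    - destruct (MVT_gen (f tau) (phi t) (phi tau) (Derive (f tau))) as [c [Hcb Ec]].
      + intros x _. apply Derive_correct. now apply Hex.
      + intros x _. apply continuity_pt_filterlim.
        apply (ex_derive_continuous (V := R_NormedModule)). now apply Hex.
      + rewrite Ec. replace (Derive (f tau) c * (phi tau - phi t) / (phi tau - phi t))
          with (Derive (f tau) c) by (field; lra).
        apply H1; [exact Htau | lra |].
        eapply Rle_lt_trans; [|exact H2].
        revert Hcb. unfold Rmin, Rmax.
        destruct (Rle_dec (phi t) (phi tau)); intros Hcb.
        * rewrite !Rabs_pos_eq; lra.
        * rewrite !Rabs_left1; lra. }
  unfold is_derive_on in *.
  apply filterlim_ext with (fun tau =>
    (f tau (phi t) - f t (phi t)) / (tau - t) + k tau * ((phi tau - phi t) / (tau - t))).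
  - intros tau. unfold k. destruct (Req_EM_T (phi tau) (phi t)) as [E|E].
    + rewrite E, Rminus_diag. unfold Rdiv. rewrite Rmult_0_l, Rmult_0_r, Rplus_0_r.
      reflexivity.
    + destruct (Req_dec tau t) as [->|Hne]; [contradiction|].
      Req. field. split; lra.
  - eapply filterlim_comp_2; [exact Hft | |apply (filterlim_plus (V := R_NormedModule))].
    eapply filterlim_comp_2; [exact Hk | exact Hphi |].
    apply (filterlim_mult (K := R_AbsRing)).
Qed.

(** * Solutions along the flow *)

Lemma energy_c_sq (f g : R -> R) :
  (forall x, continuous (Derive f) x) -> (forall x, continuous g x) ->
  energy_c f g ^ 2 = / 4 * RInt (fun x => Derive f x ^ 2 + g x ^ 2) 0 1.
Proof.
  intros Hf Hg. unfold energy_c. apply pow2_sqrt.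
  apply Rmult_le_pos; [lra|]. apply RInt_ge_0; [lra | solve_ex_RInt |].
  intros x _. generalize (pow2_ge_0 (Derive f x)) (pow2_ge_0 (g x)). lra.
Qed.

Section Solution.

Variables (m s : R) (T : Rbar) (u rho : R -> R -> R) (u0 rho0 : R -> R).
Hypothesis Hm : 5 / 2 < m.
Hypothesis HT : Rbar_lt 0 T.
Hypothesis Hsol : magnetic_HS_solution s m T u rho u0 rho0.

Let ux (t : R) : R -> R := Derive (u t).
Let uxx (t : R) : R -> R := Derive (ux t).
Let rhox (t : R) : R -> R := Derive (rho t).
Let K (t : R) : R := 2 * (energy_c (u t) (rho t) ^ 2 - s * contact_angle (rho t)).

Lemma lifespan_0 : lifespan T 0.
Proof. split; [lra | exact HT]. Qed.

Lemma solution_ex_derive (t x : R) :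
  lifespan T t ->
  ex_derive (u t) x /\ ex_derive (ux t) x /\ ex_derive (rho t) x.
Proof using Hm Hsol.
  intros Ht. destruct Hsol as [Hu [Hr _]].
  split; [|split].
  - apply (sobolev_C1 m); [lra | apply (Hu t Ht)].
  - apply (sobolev_C1 (m - 1)); [lra|].
    apply (C_sobolev_derive T m u ltac:(lra) Hu t Ht).
  - apply (sobolev_C1 (m - 1)); [lra | apply (Hr t Ht)].
Qed.

Lemma family_u : continuous_family T u.
Proof using Hm Hsol. apply C_sobolev_family with m; [lra | apply Hsol]. Qed.

Lemma family_ux : continuous_family T ux.
Proof using Hm Hsol.
  apply C_sobolev_family with (m - 1); [lra|].
  apply C_sobolev_derive; [lra | apply Hsol].
Qed.

Lemma family_uxx : continuous_family T uxx.
Proof using Hm Hsol.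
  apply C_sobolev_family with (m - 1 - 1); [lra|].
  apply (C_sobolev_derive T (m - 1) ux); [lra|].
  apply C_sobolev_derive; [lra | apply Hsol].
Qed.

Lemma family_rho : continuous_family T rho.
Proof using Hm Hsol. apply C_sobolev_family with (m - 1); [lra | apply Hsol]. Qed.

Lemma family_rhox : continuous_family T rhox.
Proof using Hm Hsol.
  apply C_sobolev_family with (m - 1 - 1); [lra|].
  apply C_sobolev_derive; [lra | apply Hsol].
Qed.

Lemma solution_equations (t x : R) :
  lifespan T t ->
  is_derive_on T (fun tau => ux tau x) t
    (- (1 / 2) * ux t x ^ 2 - u t x * uxx t x + 1 / 2 * rho t x ^ 2
     - (s * rho t x + K t)) /\
  is_derive_on T (fun tau => rho tau x) t
    (- (rhox t x * u t x + rho t x * ux t x) + s * ux t x).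
Proof using Hm Hsol.
  intros Ht. destruct (solution_ex_derive t x Ht) as [E1 [_ E3]].
  destruct Hsol as [_ [_ [_ [_ H]]]]. destruct (H t x Ht) as [H1 H2].
  split; [exact H1|].
  rewrite Derive_mult in H2 by assumption. exact H2.
Qed.

Ltac solve_family :=
  repeat first
    [ apply family_u | apply family_ux | apply family_uxx
    | apply family_rho | apply family_rhox | apply family_cst
    | apply family_plus | apply family_mult ].

Lemma energy_family : continuous_family T (fun t x => ux t x * ux t x + rho t x * rho t x).
Proof using Hm Hsol. solve_family. Qed.

Lemma energy_c_RInt (t : R) :
  lifespan T t ->
  energy_c (u t) (rho t) ^ 2
  = / 4 * RInt (fun x => ux t x * ux t x + rho t x * rho t x) 0 1.
Proof using Hm Hsol.
  intros Ht. rewrite energy_c_sq.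
  - f_equal. apply RInt_ext. intros x _. unfold ux. Req. ring.
  - now apply (proj1 family_ux t Ht).
  - now apply (proj1 family_rho t Ht).
Qed.

(** Continuity of the nonlocal term in time must precede conservation of the energy, whose proof
    differentiates an integral containing [K]. *)
Lemma family_K : continuous_family T (fun t _ => K t).
Proof using Hm Hsol.
  apply (family_const T K).
  assert (H1 := family_RInt T _ energy_family).
  assert (H2 := family_RInt T _ family_rho).
  assert (H := family_plus T _ _
    (family_mult T _ _ (family_cst T (/ 2)) (family_const T _ H1))
    (family_mult T _ _ (family_cst T (- s)) (family_const T _ H2))).
  intros t Ht eps Heps. destruct (proj2 H t Ht eps Heps) as [eta [Heta Hl]].
  exists eta. split; [exact Heta|]. intros tau Htau Hd.
  specialize (Hl tau Htau Hd 0).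
  unfold K, contact_angle. rewrite !energy_c_RInt by assumption.
  eapply Rle_lt_trans; [|exact Hl]. right. f_equal. field.
Qed.

(** rho_t is the x-derivative of - rho u + s u. *)
Lemma rho_mean_conserved (t : R) :
  lifespan T t -> contact_angle (rho t) = contact_angle rho0.
Proof using Hm HT Hsol.
  intros Ht. unfold contact_angle. f_equal.
  replace rho0 with (rho 0)
    by (apply functional_extensionality; apply Hsol).
  apply (conserved_integral T rho
    (fun t x => - 1 * (rhox t x * u t x + rho t x * ux t x) + s * ux t x)
    (fun t x => - (rho t x * u t x) + s * u t x)); [solve_family | solve_family | | | |exact Ht].
  - intros tau x H0 Htau. apply is_derive_on_interior with T; [exact H0 | exact Htau |].
    replace (-1 * _) with (- (rhox tau x * u tau x + rho tau x * ux tau x)) by ring.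
    now apply solution_equations.
  - intros tau x Htau. destruct (solution_ex_derive tau x Htau) as [E1 [_ E3]].
    unfold rhox, ux. auto_derive; [now split|].
    change (Derive (fun x => rho tau x)) with (Derive (rho tau)).
    change (Derive (fun x => u tau x)) with (Derive (u tau)). Req. ring.
  - intros tau Htau. replace 1 with (0 + 1) by ring.
    rewrite (proj1 (proj1 family_rho tau Htau)), (proj1 (proj1 family_u tau Htau)).
    reflexivity.
Qed.

(** In 2 u_x u_tx + 2 rho rho_t the terms in s rho u_x cancel, and the rest is the x-derivative of -
    u u_x^2 - u rho^2 - 2 K u, since K does not depend on x. *)
Lemma energy_conserved (t : R) :
  lifespan T t -> energy_c (u t) (rho t) ^ 2 = energy_c u0 rho0 ^ 2.
Proof using Hm HT Hsol.
  intros Ht.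
  replace rho0 with (rho 0) by (apply functional_extensionality; apply Hsol).
  replace u0 with (u 0) by (apply functional_extensionality; apply Hsol).
  rewrite !energy_c_RInt by (exact Ht || apply lifespan_0). f_equal.
  set (dux := fun t x => (-1 / 2) * (ux t x * ux t x) + (- 1) * (u t x * uxx t x)
    + 1 / 2 * (rho t x * rho t x) + (- s) * rho t x + (- 1) * K t).
  set (drho := fun t x => - 1 * (rhox t x * u t x + rho t x * ux t x) + s * ux t x).
  assert (Hdux : continuous_family T dux)
    by (assert (HK := family_K); unfold dux; clearbody K; solve_family; exact HK).
  assert (Hdrho : continuous_family T drho) by (unfold drho; solve_family).
  apply (conserved_integral T (fun t x => ux t x * ux t x + rho t x * rho t x)
    (fun t x => 2 * (ux t x * dux t x) + 2 * (rho t x * drho t x))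
    (fun t x => - (u t x * (ux t x) ^ 2) - u t x * rho t x ^ 2 - 2 * K t * u t x));
    [exact energy_family | clearbody dux drho; solve_family; assumption | | | |exact Ht].
  - intros tau x H0 Htau. destruct (solution_equations tau x Htau) as [H1 H2].
    apply is_derive_on_interior in H1; [|exact H0 | exact Htau].
    apply is_derive_on_interior in H2; [|exact H0 | exact Htau].
    assert (E1 : is_derive (fun tau => ux tau x) tau (dux tau x)).
    { replace (dux tau x) with (- (1 / 2) * ux tau x ^ 2 - u tau x * uxx tau x
        + 1 / 2 * rho tau x ^ 2 - (s * rho tau x + K tau)) by (unfold dux; field).
      exact H1. }
    assert (E2 : is_derive (fun tau => rho tau x) tau (drho tau x)).
    { replace (drho tau x)
        with (- (rhox tau x * u tau x + rho tau x * ux tau x) + s * ux tau x)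
        by (unfold drho; ring).
      exact H2. }
    replace (2 * (ux tau x * dux tau x) + 2 * (rho tau x * drho tau x))
      with (plus (plus (mult (dux tau x) (ux tau x)) (mult (ux tau x) (dux tau x)))
              (plus (mult (drho tau x) (rho tau x)) (mult (rho tau x) (drho tau x))))
      by (unfold plus, mult; simpl; ring).
    apply (is_derive_plus (fun tau => ux tau x * ux tau x)
             (fun tau => rho tau x * rho tau x)).
    + apply (is_derive_mult (fun tau => ux tau x) (fun tau => ux tau x));
        [exact E1 | exact E1 | exact Rmult_comm].
    + apply (is_derive_mult (fun tau => rho tau x) (fun tau => rho tau x));
        [exact E2 | exact E2 | exact Rmult_comm].
  - intros tau x Htau. destruct (solution_ex_derive tau x Htau) as [E1 [E2 E3]].
    unfold dux, drho, rhox, uxx. auto_derive; [now repeat split|].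
    change (Derive (fun x => rho tau x)) with (Derive (rho tau)).
    change (Derive (fun x => u tau x)) with (ux tau).
    change (Derive (fun x => ux tau x)) with (Derive (ux tau)). Req. field.
  - intros tau Htau. replace 1 with (0 + 1) by ring.
    rewrite (proj1 (proj1 family_rho tau Htau)), (proj1 (proj1 family_u tau Htau)),
      (proj1 (proj1 family_ux tau Htau)).
    reflexivity.
Qed.

(** The transport terms - u u_xx and - u rho_x cancel against the derivative along the flow, and
    conservation replaces c and delta of time t by the initial ones. *)
Lemma solution_lagrangian (phi : R -> R -> R) :
  is_flow T u phi ->
  lagrangian_system s (energy_c u0 rho0) (contact_angle rho0) T
    (fun t x => Derive (u t) (phi t x)) (fun t x => rho t (phi t x)).
Proof using Hm HT Hsol.
  intros [_ Hphi] t x Ht.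
  assert (Hc : continuous_on T (fun tau => phi tau x)).
  { apply is_derive_on_continuous with (fun tau => u tau (phi tau x)).
    intros tau Htau. now apply Hphi. }
  destruct (solution_equations t (phi t x) Ht) as [H1 H2].
  rewrite <- (rho_mean_conserved t Ht), <- (energy_conserved t Ht).
  assert (F1 := is_derive_on_along T ux (fun tau => phi tau x) t _ _ Ht
    (fun tau y Htau => proj1 (proj2 (solution_ex_derive tau y Htau)))
    family_uxx H1 (Hphi t x Ht) Hc).
  assert (F2 := is_derive_on_along T rho (fun tau => phi tau x) t _ _ Ht
    (fun tau y Htau => proj2 (proj2 (solution_ex_derive tau y Htau)))
    family_rhox H2 (Hphi t x Ht) Hc).
  split.
  - eapply eq_ind; [exact F1|]. unfold uxx, K, ux. Req. ring.
  - eapply eq_ind; [exact F2|]. unfold rhox, ux. Req. ring.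
Qed.

End Solution.

(** * Blow-up *)

(** Translating the period puts x at the left end, so a positive value there gives a positive
    integral over some [0, eta]. *)
Lemma RInt_zero_periodic (g : R -> R) :
  (forall x, g (x + 1) = g x) -> (forall x, continuous g x) ->
  (forall x, 0 <= g x) -> RInt g 0 1 = 0 -> forall x, g x = 0.
Proof.
  intros Hp Hc Hpos H0 x. apply Rle_antisym; [|apply Hpos].
  apply Rnot_lt_le. intros Hx.
  rewrite <- (RInt_periodic_shift g Hp Hc x) in H0.
  assert (Hs := continuous_shift g x Hc).
  destruct (proj1 (continuous_eps g x) (Hc x) (g x) Hx) as [eta0 [Heta0 Hl]].
  set (eta := Rmin eta0 (1 / 2)).
  assert (He1 : eta <= eta0) by apply Rmin_l.
  assert (He2 : eta <= 1 / 2) by apply Rmin_r.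
  assert (He : 0 < eta) by (unfold eta; apply Rmin_glb_lt; lra).
  rewrite <- (RInt_Chasles (V := R_CompleteNormedModule) _ 0 eta 1) in H0
    by solve_ex_RInt.
  assert (H1 : 0 < RInt (fun t => g (x + t)) 0 eta).
  { apply RInt_gt_0; [exact He | | intros; apply Hs].
    intros t Ht. specialize (Hl (x + t)).
    replace (x + t - x) with t in Hl by ring. rewrite Rabs_pos_eq in Hl by lra.
    specialize (Hl ltac:(lra)). apply Rabs_lt_between in Hl. lra. }
  assert (H2 : 0 <= RInt (fun t => g (x + t)) eta 1).
  { apply RInt_ge_0; [lra | solve_ex_RInt | intros; apply Hpos]. }
  unfold plus in H0; simpl in H0. lra.
Qed.

(* By Cauchy-Schwarz the discriminant (s - 2 delta)^2 + 4 (1 - delta^2) is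
   nonnegative, and it vanishes only at the stationary states. *)
Lemma discriminant_cases (s : R) (u0 rho0 : R -> R) :
  (forall x, u0 (x + 1) = u0 x) -> (forall x, continuous (Derive u0) x) ->
  (forall x, rho0 (x + 1) = rho0 x) -> (forall x, continuous rho0 x) ->
  energy_c u0 rho0 = 1 ->
  let D := s ^ 2 + 4 * (energy_c u0 rho0 ^ 2 - s * contact_angle rho0) in
  0 < D \/ D = 0 /\ forall x, Derive u0 x = 0 /\ rho0 x = s.
Proof.
  intros Hpu Hcu Hpr Hcr Hc D.
  set (delta := contact_angle rho0) in *.
  (* 2 delta is the mean of rho0, so the integral of g is the energy 4 minus 4 delta^2; its
     nonnegativity is the Cauchy-Schwarz inequality, with the equality case readable from g = 0. *)
  set (g := fun x => Derive u0 x ^ 2 + (rho0 x - 2 * delta) ^ 2).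
  assert (Hg0 : forall x, 0 <= g x).
  { intros x. unfold g.
    generalize (pow2_ge_0 (Derive u0 x)) (pow2_ge_0 (rho0 x - 2 * delta)). lra. }
  assert (Hgc : forall x, continuous g x) by (clearbody delta; unfold g; solve_continuous).
  assert (Hgp : forall x, g (x + 1) = g x).
  { intros x. unfold g. now rewrite Hpr, Derive_periodic. }
  assert (HI : RInt g 0 1 = 4 * (1 - delta ^ 2)).
  { assert (E1 := energy_c_sq u0 rho0 Hcu Hcr). rewrite Hc in E1.
    assert (E2 : 2 * delta = RInt rho0 0 1) by (unfold delta, contact_angle; field).
    rewrite (RInt_ext g (fun x => (Derive u0 x ^ 2 + rho0 x ^ 2)
      - ((4 * delta) * rho0 x - 4 * delta ^ 2)))
      by (intros x _; unfold g; Req; ring).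
    clearbody delta.
    rewrite !RInt_Rminus, RInt_Rscal, RInt_const by solve_continuous.
    change (scal (1 - 0) (4 * delta ^ 2)) with ((1 - 0) * (4 * delta ^ 2)).
    rewrite <- E2.
    assert (E3 : RInt (fun x => Derive u0 x ^ 2 + rho0 x ^ 2) 0 1 = 4) by lra.
    rewrite E3. Req. ring. }
  assert (HD : D = (s - 2 * delta) ^ 2 + RInt g 0 1)
    by (rewrite HI; unfold D; rewrite Hc; ring).
  assert (HI0 : 0 <= RInt g 0 1)
    by (apply RInt_ge_0; [lra | solve_ex_RInt | intros; apply Hg0]).
  assert (Hsq := pow2_ge_0 (s - 2 * delta)).
  destruct (Rle_lt_dec D 0) as [H|H]; [right | now left].
  split; [lra|]. intros x.
  assert (Hgx := RInt_zero_periodic g Hgp Hgc Hg0 ltac:(lra) x).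
  assert (Hs : s - 2 * delta = 0) by nra.
  unfold g in Hgx. assert (P1 := pow2_ge_0 (Derive u0 x)).
  assert (P2 := pow2_ge_0 (rho0 x - 2 * delta)). split; nra.
Qed.

(** The shift z = W - s completes the square: W^2 / 2 - s W - 2 (c^2 - s delta) = z^2 / 2 - om^2 /
    2, and the equation for W becomes z' = - z V. *)
Lemma lagrangian_riccati (s c delta om : R) (T : Rbar) (V W : R -> R -> R) (x b : R) :
  lagrangian_system s c delta T V W ->
  om ^ 2 = s ^ 2 + 4 * (c ^ 2 - s * delta) -> lifespan T b ->
  riccati_on om b (fun t => V (Rmax 0 t) x) (fun t => W (Rmax 0 t) x - s).
Proof.
  intros HL Hom Hb.
  assert (Hin : forall t, 0 <= t <= b -> lifespan T t)
    by (intros t Ht; now apply lifespan_le with b).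
  assert (HVc : continuous_on T (fun t => V t x))
    by (eapply is_derive_on_continuous; intros t Ht; exact (proj1 (HL t x Ht))).
  assert (HWc : continuous_on T (fun t => W t x))
    by (eapply is_derive_on_continuous; intros t Ht; exact (proj2 (HL t x Ht))).
  split.
  - intros t Ht. split.
    + exact (continuous_on_clamp T _ t HVc (Hin t Ht)).
    + apply continuous_Rminus; [|apply continuous_const].
      exact (continuous_on_clamp T _ t HWc (Hin t Ht)).
  - intros t Ht. assert (Hl := Hin t ltac:(lra)).
    destruct (HL t x Hl) as [H1 H2].
    apply is_derive_on_interior in H1; [|lra | exact Hl].
    apply is_derive_on_interior in H2; [|lra | exact Hl].
    apply is_derive_clamp in H1; [|lra]. apply is_derive_clamp in H2; [|lra].
    rewrite Rmax_right by lra. split.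
    + eapply eq_ind; [exact H1|]. rewrite Hom. Req. field.
    + apply (eq_ind _ (is_derive (fun tau => W (Rmax 0 tau) x - s) t)
        (is_derive_minus (fun tau => W (Rmax 0 tau) x) (fun _ => s) t _ _ H2
           (is_derive_const s t))).
      unfold minus, plus, opp, zero; simpl. ring.
Qed.

Definition Vsol (om v0 z0 t : R) : R :=
  (dwre om v0 t * wre om v0 t + dwim om z0 t * wim om z0 t) / wsq om v0 z0 t.

Lemma lagrangian_explicit (s c delta om : R) (T : Rbar) (V W : R -> R -> R) (x b : R) :
  lagrangian_system s c delta T V W ->
  om ^ 2 = s ^ 2 + 4 * (c ^ 2 - s * delta) -> om <> 0 -> lifespan T b ->
  wsq om (V 0 x) (W 0 x - s) b <> 0 /\
  V b x = Vsol om (V 0 x) (W 0 x - s) b /\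
  W b x = s + (W 0 x - s) / wsq om (V 0 x) (W 0 x - s) b.
Proof.
  intros HL Hom Hom0 Hb.
  assert (Hr := lagrangian_riccati s c delta om T V W x b HL Hom Hb).
  assert (Hb0 : 0 <= b) by apply Hb.
  destruct (riccati_explicit om b _ _ Hom0 Hb0 Hr) as [H1 [H2 H3]].
  rewrite (Rmax_left 0 0), (Rmax_right 0 b) in * by lra.
  split; [exact H1|]. split; [exact H2|]. rewrite <- H3. ring.
Qed.

Lemma lagrangian_stationary (s c delta : R) (T : Rbar) (V W : R -> R -> R) (x b : R) :
  lagrangian_system s c delta T V W ->
  s ^ 2 + 4 * (c ^ 2 - s * delta) = 0 -> V 0 x = 0 -> W 0 x = s -> lifespan T b ->
  V b x = 0 /\ W b x = s.
Proof.
  intros HL Hom HV HW Hb.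
  assert (Hr := lagrangian_riccati s c delta 0 T V W x b HL ltac:(lra) Hb).
  assert (Hb0 : 0 <= b) by apply Hb.
  destruct (riccati_stationary b _ _ Hb0 Hr) as [H1 H2];
    rewrite ?(Rmax_left 0 0), ?(Rmax_right 0 b) in * by lra; lra.
Qed.

(** Converse of [lagrangian_explicit]: the formulas solve the system wherever w does not vanish,
    which provides the continuation beyond T. *)
Lemma Vsol_lagrangian (s c delta om v0 z0 t : R) :
  om ^ 2 = s ^ 2 + 4 * (c ^ 2 - s * delta) -> om <> 0 -> wsq om v0 z0 t <> 0 ->
  is_derive (Vsol om v0 z0) t
    (- (1 / 2) * Vsol om v0 z0 t ^ 2 + 1 / 2 * (s + z0 / wsq om v0 z0 t) ^ 2
     - (s * (s + z0 / wsq om v0 z0 t) + 2 * (c ^ 2 - s * delta))) /\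
  is_derive (fun tau => s + z0 / wsq om v0 z0 tau) t
    (- (s + z0 / wsq om v0 z0 t) * Vsol om v0 z0 t + s * Vsol om v0 z0 t).
Proof.
  intros Hom Hom0 HD.
  assert (Hw := w_wronskian om v0 z0 t Hom0).
  assert (HA := is_derive_wre om v0 t Hom0).
  assert (HB := is_derive_wim om z0 t Hom0).
  assert (HA2 := is_derive_dwre om v0 t Hom0).
  assert (HB2 := is_derive_dwim om z0 t Hom0).
  replace (2 * (c ^ 2 - s * delta)) with (om ^ 2 / 2 - s ^ 2 / 2) by (rewrite Hom; field).
  unfold Vsol, wsq in *.
  set (A := wre om v0) in *. set (B := wim om z0) in *.
  set (A2 := dwre om v0) in *. set (B2 := dwim om z0) in *.
  clearbody A B A2 B2. split.
  - auto_derive.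
    + repeat split; try (eexists; eassumption). simpl in HD. exact HD.
    (* [Hw] trades z0 for Im (2 w' conj w); the claim is then a rational identity in the parts of w
       and 2 w'. *)
    + rewrite (Derive_eta A t _ HA), (Derive_eta B t _ HB),
        (Derive_eta A2 t _ HA2), (Derive_eta B2 t _ HB2), <- Hw.
      Req. field. exact HD.
  - auto_derive.
    + repeat split; try (eexists; eassumption). simpl in HD. exact HD.
    + rewrite (Derive_eta A t _ HA), (Derive_eta B t _ HB). Req. field. exact HD.
Qed.

Lemma nonpositive_left_limit (h : R -> R) (b : R) :
  0 < b -> continuous h b -> (forall t, 0 <= t < b -> h t <= 0) -> h b <= 0.
Proof.
  intros Hb Hc Hle. apply Rnot_lt_le. intros H.
  destruct (proj1 (continuous_eps h b) Hc (h b) H) as [eta [Heta Hl]].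
  set (t := b - Rmin (b / 2) (eta / 2)).
  assert (H1 := Rmin_l (b / 2) (eta / 2)). assert (H2 := Rmin_r (b / 2) (eta / 2)).
  assert (H3 : 0 < Rmin (b / 2) (eta / 2)) by (apply Rmin_glb_lt; lra).
  specialize (Hle t ltac:(unfold t; lra)). specialize (Hl t).
  rewrite Rabs_left1 in Hl by (unfold t; lra).
  specialize (Hl ltac:(unfold t; lra)). apply Rabs_lt_between in Hl. lra.
Qed.

(* The infimum L of f over the zero set of g makes g^2 + |f - L| vanish at its minimum
   over a period. *)
Lemma min_on_zero_set (f g : R -> R) (x0 : R) :
  (forall x, f (x + 1) = f x) -> (forall x, continuous f x) ->
  (forall x, g (x + 1) = g x) -> (forall x, continuous g x) -> g x0 = 0 ->
  exists x1, g x1 = 0 /\ forall x, g x = 0 -> f x1 <= f x.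
Proof.
  intros Hpf Hcf Hpg Hcg H0.
  destruct (periodic_bounded f Hpf Hcf) as [M [HM Hf]].
  (* Completeness yields a supremum, so [L] is minus the infimum and the distance to it reads |f +
     L|. *)
  destruct (completeness (fun y => exists x, g x = 0 /\ y = - f x)) as [L [HL1 HL2]].
  - exists M. intros y [x [_ ->]]. specialize (Hf x). apply Rabs_le_between in Hf. lra.
  - exists (- f x0). now exists x0.
  - set (h := fun x => g x ^ 2 + Rabs (f x + L)).
    assert (Hge : forall x, g x = 0 -> 0 <= f x + L).
    { intros x Hx. assert (H := HL1 (- f x) ltac:(now exists x)). lra. }
    destruct (continuity_ab_min h 0 1) as [x1 [Hmin _]]; [lra | |].
    + intros x _. apply continuity_pt_filterlim.
      apply (continuous_Rplus (fun x => g x ^ 2) (fun x => Rabs (f x + L)));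
        [solve_continuous|].
      apply (continuous_comp (fun x => f x + L) Rabs);
        [solve_continuous | apply continuous_Rabs].
    + assert (Hmin' : forall x, h x1 <= h x).
      { intros x. destruct (representative_mod_1 x) as [z Hz].
        specialize (Hmin _ Hz). unfold h in *.
        now rewrite (periodic_IZR f Hpf z x), (periodic_IZR g Hpg z x) in Hmin. }
      assert (Hh : h x1 <= 0).
      { apply Rnot_lt_le. intros Hh.
        (* On the zero set h = f + L is at least h x1, so a positive minimum would leave L - h x1 /
           2 as a smaller upper bound of - f. *)
        enough (L <= L - h x1 / 2) by lra. apply HL2. intros y [x [Hx ->]].
        specialize (Hmin' x). unfold h in Hmin' at 2.
        rewrite Hx, Rabs_pos_eq in Hmin' by now apply Hge. lra. }
      unfold h in Hh. assert (P1 := pow2_ge_0 (g x1)).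
      assert (P2 := Rabs_pos (f x1 + L)).
      exists x1. split; [nra|]. intros x Hx. specialize (Hge x Hx).
      assert (Hz : Rabs (f x1 + L) = 0) by lra.
      assert (P3 := Rle_abs (f x1 + L)). lra.
Qed.

Lemma wre_phase (om v0 t : R) :
  om <> 0 ->
  wre om v0 t = cos (om / 2 * t - atan (v0 / om)) / cos (atan (v0 / om)).
Proof.
  intros Hom. assert (Hb := atan_bound (v0 / om)).
  assert (Ht := tan_atan (v0 / om)). unfold tan in Ht.
  set (psi := atan (v0 / om)) in *. clearbody psi.
  assert (Hc : 0 < cos psi) by (apply cos_gt_0; lra).
  assert (Hs : sin psi = v0 / om * cos psi) by (rewrite <- Ht; field; lra).
  rewrite cos_minus, Hs. unfold wre, Cos, Sin. field. split; lra.
Qed.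

(** For om > 0, the first positive zero of [wre]: the phase om t / 2 - atan (v0 / om) reaches PI /
    2. It increases with v0. *)
Definition blowup_time (om v0 : R) : R := 2 * arccot (- (v0 / om)) / om.

Lemma blowup_time_pos (om v0 : R) : 0 < om -> 0 < blowup_time om v0.
Proof.
  intros Hom. unfold blowup_time, arccot.
  assert (Hb := atan_bound (- (v0 / om))).
  apply Rdiv_lt_0_compat; lra.
Qed.

Lemma wre_blowup_time (om v0 : R) : 0 < om -> wre om v0 (blowup_time om v0) = 0.
Proof.
  intros Hom. rewrite wre_phase by lra. unfold blowup_time, arccot.
  rewrite atan_opp.
  replace (om / 2 * (2 * (PI / 2 - - atan (v0 / om)) / om) - atan (v0 / om))
    with (PI / 2) by (field; lra).
  rewrite cos_PI2. apply Rmult_0_l.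
Qed.

(** A zero of w needs z0 = 0 or Sin = 0. The second leaves |wre| = |Cos| = 1; in the first, v1 <= v0
    keeps the phase strictly between - PI / 2 and PI / 2. [v1] will be the least initial slope on
    the zero set. *)
Lemma wsq_before_blowup (om v0 z0 v1 t : R) :
  0 < om -> (z0 = 0 -> v1 <= v0) -> 0 <= t < blowup_time om v1 ->
  wsq om v0 z0 t <> 0.
Proof.
  intros Hom Hle Ht HD. unfold wsq in HD.
  assert (P1 := pow2_ge_0 (wre om v0 t)). assert (P2 := pow2_ge_0 (wim om z0 t)).
  assert (HA : wre om v0 t = 0) by nra. assert (HB : wim om z0 t = 0) by nra.
  unfold wim in HB. apply Rmult_integral in HB. destruct HB as [Hz|HS].
  - specialize (Hle Hz).
    assert (Hlt : om / 2 * t < PI / 2 + atan (v1 / om)).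
    { unfold blowup_time, arccot in Ht. rewrite atan_opp in Ht.
      replace (PI / 2 + atan (v1 / om))
        with (om / 2 * (2 * (PI / 2 - - atan (v1 / om)) / om)) by (field; lra).
      apply Rmult_lt_compat_l; lra. }
    assert (Hmono : atan (v1 / om) <= atan (v0 / om)).
    { destruct (Req_dec v1 v0) as [->|Hne]; [lra|]. left. apply atan_increasing.
      apply Rmult_lt_compat_r; [now apply Rinv_0_lt_compat | lra]. }
    assert (Hb := atan_bound (v0 / om)).
    assert (H0 : 0 <= om / 2 * t) by (apply Rmult_le_pos; lra).
    rewrite wre_phase in HA by lra.
    assert (H1 : 0 < cos (om / 2 * t - atan (v0 / om))) by (apply cos_gt_0; lra).
    assert (H2 : 0 < cos (atan (v0 / om))) by (apply cos_gt_0; lra).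
    assert (H3 := Rdiv_lt_0_compat _ _ H1 H2). lra.
  - assert (H := Cos_Sin_unit om t ltac:(lra)).
    unfold wre in HA. rewrite HS in *. assert (Cos om t = 0) by lra. nra.
Qed.

(** Pull cos (om t / 2) out of w and 2 w'. It cancels in V, while in z the remaining 1 / cos^2 is 1
    + tan^2. *)
Lemma explicit_tan (om v0 z0 t : R) :
  om <> 0 -> cos (om / 2 * t) <> 0 -> wsq om v0 z0 t <> 0 ->
  let tau := tan (om / 2 * t) in
  let den := (1 + v0 * (tau / om)) ^ 2 + (z0 * (tau / om)) ^ 2 in
  den <> 0 /\
  Vsol om v0 z0 t
    = ((- om * tau + v0) * (1 + v0 * (tau / om)) + z0 ^ 2 * (tau / om)) / den /\
  z0 / wsq om v0 z0 t = (1 + tau ^ 2) * z0 / den.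
Proof.
  intros Hom Hc HD tau den.
  assert (Hw : wre om v0 t = cos (om / 2 * t) * (1 + v0 * (tau / om)))
    by (unfold wre, Cos, Sin, tau, tan; field; now split).
  assert (Hi : wim om z0 t = cos (om / 2 * t) * (z0 * (tau / om)))
    by (unfold wim, Sin, tau, tan; field; now split).
  assert (Hdw : dwre om v0 t = cos (om / 2 * t) * (- om * tau + v0))
    by (unfold dwre, Cos, Sin, tau, tan; field; now split).
  assert (Hdi : dwim om z0 t = cos (om / 2 * t) * z0)
    by (unfold dwim, Cos; ring).
  assert (Hden : wsq om v0 z0 t = cos (om / 2 * t) ^ 2 * den)
    by (unfold wsq, den; rewrite Hw, Hi; ring).
  assert (Hden0 : den <> 0).
  { intros E. apply HD. rewrite Hden, E. ring. }
  assert (Htau : cos (om / 2 * t) ^ 2 * (1 + tau ^ 2) = 1).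
  { etransitivity; [|apply (sin2_cos2 (om / 2 * t))].
    unfold tau, tan, Rsqr. field. exact Hc. }
  split; [exact Hden0|]. split.
  - unfold Vsol. rewrite Hden, Hw, Hi, Hdw, Hdi. clearbody den. field.
    repeat split; assumption.
  - rewrite Hden. clearbody den.
    replace (z0 / (cos (om / 2 * t) ^ 2 * den))
      with (cos (om / 2 * t) ^ 2 * (1 + tau ^ 2) * z0 / (cos (om / 2 * t) ^ 2 * den))
      by (rewrite Htau; field; now split).
    field. now split.
Qed.

Lemma periodic_bounded_quotient (f g : R -> R) :
  (forall x, f (x + 1) = f x) -> (forall x, continuous f x) ->
  (forall x, g (x + 1) = g x) -> (forall x, continuous g x) ->
  (forall x, g x <> 0) ->
  exists M, 0 < M /\ forall x, Rabs (f x / g x) <= M.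
Proof.
  intros Hpf Hcf Hpg Hcg H0. apply (periodic_bounded (fun x => f x / g x)).
  - intros x. now rewrite Hpf, Hpg.
  - intros x. apply continuous_Rmult; [apply Hcf|].
    apply (continuous_comp g Rinv); [apply Hcg | now apply continuous_Rinv].
Qed.

(* If z0 has no zero, the conserved quantity (|y|^2 + om^2) / z is bounded uniformly
   in x, hence so are v and z. *)
Lemma lagrangian_bounded (s c delta om : R) (T : Rbar) (V W : R -> R -> R) :
  lagrangian_system s c delta T V W -> Rbar_lt 0 T ->
  om ^ 2 = s ^ 2 + 4 * (c ^ 2 - s * delta) ->
  (forall x, V 0 (x + 1) = V 0 x) -> (forall x, continuous (V 0) x) ->
  (forall x, W 0 (x + 1) = W 0 x) -> (forall x, continuous (W 0) x) ->
  (forall x, W 0 x <> s) ->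
  exists M, forall t x, lifespan T t -> Rabs (V t x) + Rabs (W t x) <= M.
Proof.
  intros HL HT Hom HpV HcV HpW HcW Hne.
  destruct (periodic_bounded_quotient
    (fun x => V 0 x ^ 2 + (W 0 x - s) ^ 2 + om ^ 2) (fun x => W 0 x - s))
    as [M [HM HK]].
  - intros x. now rewrite HpV, HpW.
  - solve_continuous.
  - intros x. now rewrite HpW.
  - solve_continuous.
  - intros x E. apply (Hne x). lra.
  - exists (2 * M + Rabs s). intros t x Ht.
    assert (Hr := lagrangian_riccati s c delta om T V W x t HL Hom Ht).
    assert (Ht0 : 0 <= t) by apply Ht.
    assert (E := riccati_invariant om t _ _ Ht0 Hr).
    cbv beta in E. rewrite (Rmax_left 0 0), (Rmax_right 0 t) in E by lra.
    specialize (HK x). specialize (Hne x).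
    set (k := (V 0 x ^ 2 + (W 0 x - s) ^ 2 + om ^ 2) / (W 0 x - s)) in *.
    assert (Ek : V t x ^ 2 + (W t x - s) ^ 2 + om ^ 2 = (W t x - s) * k).
    { apply Rmult_eq_reg_r with (W 0 x - s); [|lra]. rewrite E.
      unfold k. field. lra. }
    set (v := V t x) in *. set (z := W t x - s) in *.
    assert (Hk : z * k <= Rabs z * M).
    { eapply Rle_trans; [apply Rle_abs|]. rewrite Rabs_mult.
      apply Rmult_le_compat_l; [apply Rabs_pos | exact HK]. }
    assert (P1 := pow2_ge_0 om). assert (P2 := Rabs_pos z). assert (P3 := Rabs_pos v).
    assert (Z2 : z ^ 2 = Rabs z ^ 2) by (rewrite pow2_abs; reflexivity).
    assert (V2 : v ^ 2 = Rabs v ^ 2) by (rewrite pow2_abs; reflexivity).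
    assert (P4 := pow2_ge_0 (Rabs v)). assert (P5 := pow2_ge_0 (Rabs z)).
    (* From v^2 + z^2 + om^2 <= M |z|, first z^2 <= M |z| bounds z, then v^2 <= M |z| <= M^2 bounds
       v. *)
    assert (Hz : Rabs z <= M) by nra.
    assert (Hv : Rabs v <= M) by nra.
    assert (Hw : Rabs (W t x) <= Rabs z + Rabs s).
    { replace (W t x) with (z + s) by (unfold z; ring). apply Rabs_triang. }
    lra.
Qed.

(** The given [x0] need not be where blow-up comes first, and the continuation must exist at all x
    up to [t1]; hence the minimizing [x1]. There z0 = 0, so y = 2 w' / w is real with w tending to 0
    and w' not. *)
Lemma singularity_of_zero (s c delta om : R) (T : Rbar) (v w : R -> R -> R) (x0 : R) :
  lagrangian_system s c delta T v w -> Rbar_lt 0 T ->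
  om ^ 2 = s ^ 2 + 4 * (c ^ 2 - s * delta) -> 0 < om ->
  (forall x, v 0 (x + 1) = v 0 x) -> (forall x, continuous (v 0) x) ->
  (forall x, w 0 (x + 1) = w 0 x) -> (forall x, continuous (w 0) x) ->
  w 0 x0 = s ->
  develops_singularity s c delta T v w.
Proof.
  intros HL HT Hom Hom0 Hpv Hcv Hpw Hcw H0.
  destruct (min_on_zero_set (v 0) (fun x => w 0 x - s) x0) as [x1 [Hx1 Hmin]];
    try assumption; [intros x; now rewrite Hpw | solve_continuous | lra |].
  set (t1 := blowup_time om (v 0 x1)).
  assert (Ht1 : 0 < t1) by now apply blowup_time_pos.
  assert (HD : forall t x, 0 <= t < t1 -> wsq om (v 0 x) (w 0 x - s) t <> 0).
  { intros t x Ht. apply wsq_before_blowup with (v 0 x1); [exact Hom0 | | exact Ht].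
    apply Hmin. }
  exists t1, (fun t x => Vsol om (v 0 x) (w 0 x - s) t),
    (fun t x => s + (w 0 x - s) / wsq om (v 0 x) (w 0 x - s) t).
  split; [exact Ht1|]. split; [|split].
  - intros t x Ht _.
    destruct (lagrangian_explicit s c delta om T v w x t HL Hom ltac:(lra) Ht)
      as [_ [E1 E2]]. now split.
  - intros t x [Ht Htt].
    destruct (Vsol_lagrangian s c delta om (v 0 x) (w 0 x - s) t Hom ltac:(lra))
      as [E1 E2]; [now apply HD|].
    split; apply is_derive_is_derive_on; assumption.
  - intros M. apply NNPP. intros Hno.
    (* Cross-multiplied, the supposed bound reads |2 w'| <= M |w|; it passes to the limit t1, where
       w = 0 would force w' = 0. *)
    assert (Hle : forall t, 0 <= t < t1 ->
      Rabs (dwre om (v 0 x1) t) - M * Rabs (wre om (v 0 x1) t) <= 0).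
    { intros t Ht.
      assert (HDt := HD t x1 Ht).
      assert (Hb : Rabs (Vsol om (v 0 x1) (w 0 x1 - s) t) <= M).
      { apply Rnot_lt_le. intros Hlt. apply Hno. exists t, x1. split; [exact Ht|].
        eapply Rlt_le_trans; [exact Hlt|].
        generalize (Rabs_pos (s + (w 0 x1 - s) / wsq om (v 0 x1) (w 0 x1 - s) t)).
        lra. }
      rewrite Hx1 in *. unfold Vsol, wsq, wim in *.
      rewrite Rmult_0_l in *.
      set (a := wre om (v 0 x1) t) in *. set (b := dwre om (v 0 x1) t) in *.
      assert (Ha : a <> 0) by (intros E; apply HDt; rewrite E; ring).
      replace ((b * a + dwim om 0 t * 0) / (a ^ 2 + 0 ^ 2)) with (b / a) in Hb
        by (field; exact Ha).
      replace b with (b / a * a) by (field; exact Ha). rewrite Rabs_mult.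
      assert (Rabs (b / a) * Rabs a <= M * Rabs a)
        by (apply Rmult_le_compat_r; [apply Rabs_pos | exact Hb]).
      lra. }
    assert (Hlim : Rabs (dwre om (v 0 x1) t1) - M * Rabs (wre om (v 0 x1) t1) <= 0).
    { apply (nonpositive_left_limit
        (fun t => Rabs (dwre om (v 0 x1) t) - M * Rabs (wre om (v 0 x1) t)));
        [exact Ht1 | | exact Hle].
      apply (continuous_Rminus (fun t => Rabs (dwre om (v 0 x1) t))
        (fun t => M * Rabs (wre om (v 0 x1) t))).
      - apply (continuous_comp (dwre om (v 0 x1)) Rabs);
          [apply continuous_dwre | apply continuous_Rabs].
      - apply continuous_Rmult; [apply continuous_const|].
        apply (continuous_comp (wre om (v 0 x1)) Rabs);
          [apply continuous_wre | apply continuous_Rabs]. }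
    assert (Hw1 : wre om (v 0 x1) t1 = 0) by now apply wre_blowup_time.
    rewrite Hw1, Rabs_R0 in Hlim.
    apply (w_dw_independent om (v 0 x1) t1); [lra|]. split; [exact Hw1|].
    assert (P := Rle_abs (dwre om (v 0 x1) t1)).
    assert (P' := Rle_abs (- dwre om (v 0 x1) t1)). rewrite Rabs_Ropp in P'. lra.
Qed.

(** The Riccati variable is rho o phi - s, so rho o phi itself carries the summand [s]; at t = 0 the
    quotient reduces to rho0 - s. The condition on the cosine excludes the poles of the tangent,
    where the solution may well be regular. *)
Theorem theorem3p2 (m s : R) (T : Rbar) (u rho phi : R -> R -> R)
    (u0 rho0 : R -> R)
    (hm : 5 / 2 < m)
    (hT : Rbar_lt 0 T)
    (hu0 : sobolev m u0)
    (hrho0 : sobolev (m - 1) rho0)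
    (hsol : magnetic_HS_solution s m T u rho u0 rho0)
    (hphi : is_flow T u phi) :
  let c := energy_c u0 rho0 in
  let delta := contact_angle rho0 in
  let omega := theta1 s c delta - theta2 s c delta in
  let Tom := fun t => tan (omega / 2 * t) in
  let den := fun t x =>
    (1 + Derive u0 x * (Tom t / omega)) ^ 2
    + ((rho0 x - s) * (Tom t / omega)) ^ 2 in
  c = 1 ->
  delta <> 0 ->
  (forall t x, lifespan T t -> cos (omega / 2 * t) <> 0 ->
     den t x <> 0 /\
     Derive (u t) (phi t x) =
       ((- omega * Tom t + Derive u0 x) * (1 + Derive u0 x * (Tom t / omega))
        + (rho0 x - s) ^ 2 * (Tom t / omega)) / den t x /\
     rho t (phi t x) = s + (1 + Tom t ^ 2) * (rho0 x - s) / den t x) /\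
  (develops_singularity s c delta T
     (fun t x => Derive (u t) (phi t x)) (fun t x => rho t (phi t x)) <->
   exists x0 t0 : R,
     0 < t0 /\ rho0 x0 = s /\
     t0 = 2 * arccot (- (Derive u0 x0 / omega)) / omega).
Proof.
  intros c delta om Tom den Hc _.
  assert (HL := solution_lagrangian m s T u rho u0 rho0 hm hT hsol phi hphi).
  fold c delta in HL.
  set (V := fun t x => Derive (u t) (phi t x)) in *.
  set (W := fun t x => rho t (phi t x)) in *.
  assert (HV0 : forall x, V 0 x = Derive u0 x).
  { intros x. unfold V. rewrite (proj1 hphi). apply Derive_ext. apply hsol. }
  assert (HW0 : forall x, W 0 x = rho0 x).
  { intros x. unfold W. rewrite (proj1 hphi). apply hsol. }
  assert (Hcu : forall x, continuous (Derive u0) x)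
    by (apply (sobolev_C1 m); [lra | exact hu0]).
  assert (Hpu : forall x, Derive u0 (x + 1) = Derive u0 x)
    by (apply Derive_periodic, hu0).
  destruct hrho0 as [Hpr [Hcr _]].
  assert (Hl0 : lifespan T 0) by (split; [lra | exact hT]).
  assert (HDisc := discriminant_cases s u0 rho0 (proj1 hu0) Hcu Hpr Hcr Hc).
  cbv zeta in HDisc. fold c delta in HDisc.
  set (D := s ^ 2 + 4 * (c ^ 2 - s * delta)) in *.
  assert (Eom : om = sqrt D) by (unfold om, theta1, theta2; fold D; field).
  clearbody om. destruct HDisc as [HDpos|[HD0 Hstat]].
  - assert (Hom : 0 < om) by (rewrite Eom; now apply sqrt_lt_R0).
    assert (Hom2 : om ^ 2 = D) by (rewrite Eom; apply pow2_sqrt; lra).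
    split.
    + intros t x Ht Hcos.
      destruct (lagrangian_explicit s c delta om T V W x t HL Hom2 ltac:(lra) Ht)
        as [Hw [E1 E2]].
      rewrite HV0, HW0 in *.
      destruct (explicit_tan om (Derive u0 x) (rho0 x - s) t ltac:(lra) Hcos Hw)
        as [F1 [F2 F3]].
      split; [exact F1|]. split.
      * etransitivity; [exact E1 | exact F2].
      * etransitivity; [exact E2|]. now rewrite F3.
    + split.
      * intros [t1 [V1 [W1 [Ht1 [Hag [HL1 Hub]]]]]].
        assert (H10 : lifespan t1 0) by (split; [lra | exact Ht1]).
        assert (EV : V1 0 = Derive u0).
        { apply functional_extensionality. intros x. rewrite <- HV0. now apply Hag. }
        assert (EW : W1 0 = rho0).
        { apply functional_extensionality. intros x. rewrite <- HW0. now apply Hag. }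
        apply NNPP. intros Hno.
        destruct (lagrangian_bounded s c delta om t1 V1 W1 HL1 Ht1 Hom2) as [M HM];
          rewrite ?EV, ?EW; try assumption.
        (* For omega > 0 the time t0 is determined by x0 and positive, so absence of a pair (x0, t0)
           means that rho0 never takes the value s. *)
        { intros x Hx. apply Hno. exists x, (blowup_time om (Derive u0 x)).
          split; [now apply blowup_time_pos | now split]. }
        destruct (Hub M) as [t [x [Ht Hlt]]]. specialize (HM t x Ht). lra.
      * intros [x0 [t0 [_ [Hx0 _]]]].
        assert (EV : V 0 = Derive u0) by now apply functional_extensionality.
        assert (EW : W 0 = rho0) by now apply functional_extensionality.
        apply (singularity_of_zero s c delta om T V W x0); rewrite ?EV, ?EW;
          assumption.
  (* Stationary case: division by zero yields 0, so T_omega / omega = 0 and the formulas reduce to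
     u_x = 0, rho = s. Both sides of (2) fail: the pair stays constant, and t0 evaluates to 0. *)
  - assert (Hom : om = 0) by (rewrite Eom, HD0; apply sqrt_0).
    split.
    + intros t x Ht _.
      destruct (lagrangian_stationary s c delta T V W x t HL HD0) as [E1 E2];
        [now rewrite HV0; apply Hstat | now rewrite HW0; apply Hstat | exact Ht |].
      destruct (Hstat x) as [S1 S2].
      assert (ET : Tom t / om = 0) by (rewrite Hom; unfold Rdiv; rewrite Rinv_0; ring).
      assert (Eden : den t x = 1) by (unfold den; rewrite ET; ring).
      rewrite Eden, S1, S2, ET, Hom.
      split; [lra|]. split.
      * etransitivity; [exact E1 | field].
      * etransitivity; [exact E2 | field].
    + split.
      * intros [t1 [V1 [W1 [Ht1 [Hag [HL1 Hub]]]]]].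
        assert (H10 : lifespan t1 0) by (split; [lra | exact Ht1]).
        destruct (Hub (Rabs s)) as [t [x [Ht Hlt]]].
        destruct (Hag 0 x Hl0 H10) as [A1 A2].
        destruct (Hstat x) as [S1 S2].
        destruct (lagrangian_stationary s c delta t1 V1 W1 x t HL1 HD0) as [E1 E2];
          [rewrite A1, HV0; exact S1 | rewrite A2, HW0; exact S2 | exact Ht |].
        rewrite E1, E2, Rabs_R0 in Hlt. lra.
      * intros [x0 [t0 [Ht0 [_ E]]]].
        rewrite Hom in E. unfold Rdiv in E. rewrite Rinv_0, Rmult_0_r in E. lra.
Qed.
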